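(* Let $G$ be an arbitrary group, let $H=\bigoplus_{g\in G}H_g$ be a faithfully $G$-graded quasi-Hopf algebra over a field $\Bbbk$, let $N\unlhd G$ and let $J\subseteq H_e$ be a $G$-invariant quasi-Hopf ideal of $H_e$. There is a quasi-Hopf ideal $I\subseteq H$ with $N_I=N$ and $I\cap H_e=J$ if and only if $(N,J)$ admits an equivariant family.
   Context: Conventions. $\Bbbk$ is a field; vector spaces, algebras and tensor products are over $\Bbbk$; algebras are unital and algebra (anti-)morphisms preserve units. For subspaces $U,V$ of an algebra, $UV$ is the linear span of the products $uv$. Summation is suppressed: $\Delta(x)=x'\otimes x''$, $\Phi=\Phi^{(1)}\otimes\Phi^{(2)}\otimes\Phi^{(3)}$, $\Phi^{-1}=\Phi^{(-1)}\otimes\Phi^{(-2)}\otimes\Phi^{(-3)}$. Quasi-Hopf algebras. A quasi-Hopf algebra is an algebra $H$ with algebra morphisms $\Delta\colon H\to H\otimes H$, $\varepsilon\colon H\to\Bbbk$, an invertible $\Phi\in H^{\otimes 3}$, an algebra anti-morphism $S\colon H\to H$ (not assumed bijective) and elements $\alpha,\beta\in H$ such that for all $x\in H$: $(1\otimes\Phi)(\mathrm{id}\otimes\Delta\otimes\mathrm{id})(\Phi)(\Phi\otimes1)=(\mathrm{id}\otimes\mathrm{id}\otimes\Delta)(\Phi)(\Delta\otimes\mathrm{id}\otimes\mathrm{id})(\Phi)$; $\Phi(\Delta\otimes\mathrm{id})(\Delta(x))=(\mathrm{id}\otimes\Delta)(\Delta(x))\Phi$; $(\mathrm{id}\otimes\varepsilon\otimes\mathrm{id})(\Phi)=1\otimes1$;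 $(\mathrm{id}\otimes\varepsilon)\Delta(x)=x=(\varepsilon\otimes\mathrm{id})\Delta(x)$; $S(x')\alpha x''=\varepsilon(x)\alpha$; $x'\beta S(x'')=\varepsilon(x)\beta$; $\Phi^{(1)}\beta S(\Phi^{(2)})\alpha\Phi^{(3)}=1=S(\Phi^{(-1)})\alpha\Phi^{(-2)}\beta S(\Phi^{(-3)})$. Throughout, $(\alpha,\beta)$ is normalized by $\varepsilon(\alpha)=\varepsilon(\beta)=1$. A morphism of quasi-Hopf algebras is an algebra morphism commuting with $\Delta,\varepsilon,S$ and carrying $\Phi,\alpha,\beta$ to $\Phi,\alpha,\beta$. A quasi-Hopf ideal of $H$ is a two-sided ideal $I$ with $\Delta(I)\subseteq I\otimes H+H\otimes I$, $\varepsilon(I)=0$, $S(I)\subseteq I$; then $H/I$ has a unique quasi-Hopf structure making $H\to H/I$ a morphism. An element $x$ is group-like if $\Delta(x)=x\otimes x$ and $\varepsilon(x)=1$. Gradings. For a group $G$ with identity $e$, a $G$-graded quasi-Hopf algebra is a quasi-Hopf algebra with a vector space decomposition $H=\bigoplus_{g\in G}H_g$ such that $H_gH_h\subseteq H_{gh}$, $\Delta(H_g)\subseteq H_g\otimes H_g$, $S(H_g)\subseteq H_{g^{-1}}$, $\Phi\in H_e^{\otimes3}$, $\alpha,\beta\in H_e$. It is faithfully graded if $H_g\neq0$ for all $g$, and strongly graded if $H_gH_h=H_{gh}$ for all $g,h$ (a faithful grading of a quasi-Hopf algebra is automatically strong). The group algebra $\Bbbk[G]$ has basis $\{\zeta_g\}_{g\in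 G}$, $\zeta_g\zeta_h=\zeta_{gh}$. The grading map of $H$ is $\pi\colon H\to\Bbbk[G]$, $\pi(x_g)=\varepsilon(x_g)\zeta_g$ for $x_g\in H_g$. For a quasi-Hopf ideal $I$ of $H$, $N_I$ is the unique normal subgroup of $G$ with $\pi(I)=\mathfrak{a}_{N_I}\cdot\Bbbk[G]$, where $\mathfrak{a}_N$ is the span of $\zeta_n-\zeta_e$, $n\in N$; explicitly $N_I=\{g\in G\mid\zeta_g-\zeta_e\in\pi(I)\}$. Lifted quotients. For $N\unlhd G$ put $H_N=\bigoplus_{n\in N}H_n$, a quasi-Hopf subalgebra. An ideal $J$ of $H_e$ is $G$-invariant if $H_gJ=JH_g$ for all $g\in G$. For a $G$-invariant quasi-Hopf ideal $J\subseteq H_e$, $J^G:=HJ=\sum_gH_gJ$ and $J^N:=H_NJ$ are quasi-Hopf ideals of $H$ and $H_N$, with $J^N=J^G\cap H_N$, $J^N\cap H_e=J$. Let $q_J\colon H\to H/J^G$ be the projection; $H/J^G$ is strongly $G$-graded with components $q_J(H_g)$. The lifted quotient $H_N/J^N$, identified with $q_J(H_N)$, is strongly $N$-graded with neutral component identified with $H_e/J$. Conjugation and equivariant families. For $g\in G$ and $x\in H/J^G$ commuting with $H_e/J$, set ${}^{g}x:=\sum_i\bar h_i x\bar h_i'$, where $\sum_i\bar h_i\bar h_i'=1$ is any finite decomposition with $\bar h_i\in q_J(H_g)$, $\bar h_i'\in q_J(H_{g^{-1}})$; this is independent of the decomposition. A group-like splitting of the grading of $H_N/J^N$ is a family $(u_n)_{n\in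 N}$ of group-like units $u_n$ of degree $n$ with $u_nu_m=u_{nm}$ and $u_nb=bu_n$ for all $b\in H_e/J$. An equivariant family for $(N,J)$ is a group-like splitting with ${}^{g}u_n=u_{gng^{-1}}$ for all $g\in G$, $n\in N$. *)

(* Defs.v *)
From HB Require Import structures.
From mathcomp Require Import all_boot all_order all_algebra finmap.
From mathcomp Require Import boolp classical_sets.
From mathcomp Require Import monalg.

Set Implicit Arguments.
Unset Strict Implicit.
Unset Printing Implicit Defensive.

Import GRing.Theory.

Local Open Scope classical_set_scope.
Local Open Scope quotient_scope.
Local Open Scope ring_scope.

Section Subspaces.
Variables (k : fieldType) (V : lmodType k).

Definition subspace (A : set V) : Prop :=
  A 0 /\ forall (a : k) (u v : V), A u -> A v -> A (a *: u + v).

Definition lspan (X : set V) : set V :=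
  [set v | exists s : seq (k * V),
     (forall p, p \in s -> X p.2) /\ v = \sum_(p <- s) p.1 *: p.2].

Definition sumset (A B : set V) : set V := [set a + b | a in A & b in B].

Lemma subspaceD A u v : subspace A -> A u -> A v -> A (u + v).
Proof. by move=> [_ h] hu hv; rewrite -[u]scale1r; apply: h. Qed.

Lemma subspaceZ A (a : k) u : subspace A -> A u -> A (a *: u).
Proof. by move=> [h0 h] hu; rewrite -[_ *: _]addr0; apply: h. Qed.

Lemma subspaceN A u : subspace A -> A u -> A (- u).
Proof. by move=> h hu; rewrite -scaleN1r; apply: subspaceZ. Qed.

Lemma subspaceB A u v : subspace A -> A u -> A v -> A (u - v).
Proof. by move=> h hu hv; apply: subspaceD => //; apply: subspaceN. Qed.

Lemma subspace_sum A (I : eqType) (s : seq I) (F : I -> V) :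
  subspace A -> (forall i, i \in s -> A (F i)) -> A (\sum_(i <- s) F i).
Proof.
move=> hA; elim: s => [|i s IH] h; first by rewrite big_nil; case: hA.
rewrite big_cons; apply: subspaceD => //; first by apply: h; rewrite inE eqxx.
by apply: IH => j hj; apply: h; rewrite inE hj orbT.
Qed.

Lemma subspace_lspan X : subspace (lspan X).
Proof.
split; first by exists [::]; rewrite big_nil.
move=> a u v [s [hs ->]] [t [ht ->]].
exists ([seq (a * p.1, p.2) | p <- s] ++ t); split.
  move=> p; rewrite mem_cat => /orP[/mapP[q qs ->] /=|]; last exact: ht.
  exact: hs.
rewrite big_cat big_map /= scaler_sumr; congr (_ + _).
by apply: eq_bigr => p _; rewrite scalerA.
Qed.

Lemma lspan0 X : lspan X 0.
Proof. by have [] := subspace_lspan X. Qed.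

Lemma lspan_sub X A : subspace A -> X `<=` A -> lspan X `<=` A.
Proof.
move=> hA hX v [s [hs ->]]; apply: subspace_sum => // p ps.
by apply: subspaceZ => //; apply/hX/hs.
Qed.

Lemma lspan_mem X x : X x -> lspan X x.
Proof.
move=> hx; exists [:: (1, x)]; split; last by rewrite big_seq1 scale1r.
by move=> p; rewrite inE => /eqP ->.
Qed.

Lemma subspace_sumset A B : subspace A -> subspace B -> subspace (sumset A B).
Proof.
move=> hA hB; split; first by exists 0; [case: hA | exists 0; [case: hB | rewrite addr0]].
move=> a _ _ [u Au [v Bv <-]] [u' Au' [v' Bv' <-]].
exists (a *: u + u'); first by case: hA => _; apply.
exists (a *: v + v'); first by case: hB => _; apply.
by rewrite scalerDr addrACA.
Qed.

(* Separating functional (Zorn); only used to see that A ⊗ B is nonzero. *)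
Lemma separating_functional (v : V) :
  v != 0 -> exists f : V -> k^o, linear f /\ f v = 1.
Proof.
move=> v0; pose P (A : set V) := subspace A /\ ~ A v \/ A = set0.
have [A [PA maxA]] : exists A, P A /\ forall B, A `<` B -> ~ P B.
  apply: Zorn_bigcup => F FP Ftot.
  have [[A [FA [a Aa]]]|Fe] := pselect (exists A, F A /\ A !=set0); last first.
    right; rewrite -subset0 => x [A FA Ax]; apply: Fe.
    by exists A; split => //; exists x.
  have ss B b : F B -> B b -> subspace B /\ ~ B v.
    by move=> /FP [//|->].
  left; split; last by move=> [B FB Bv]; case: (ss B v FB Bv).
  split; first by exists A => //; case: (ss A a FA Aa) => -[].
  move=> c x y [B FB Bx] [C FC Cy].
  case: (ss B x FB Bx) => hB _; case: (ss C y FC Cy) => hC _.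
  by case: (Ftot B C FB FC) => h; [exists C | exists B] => //;
     [case: hC | case: hB] => _; apply => //; apply: h.
have {PA} [sA Av] : subspace A /\ ~ A v.
  case: PA => // A0; exfalso; apply: (maxA [set 0]); last first.
    left; split; last by move=> /= h; rewrite h eqxx in v0.
    by split => // a x y /= -> ->; rewrite scaler0 addr0.
  by rewrite A0; split => // /(_ 0); apply.
have ex x : exists c, A (x - c *: v).
  apply: contrapT => nx.
  have nAx : ~ A x by move=> Ax; apply: nx; exists 0; rewrite scale0r subr0.
  apply: (maxA (sumset A [set c *: x | c in setT])).
    split.
      by move=> a Aa; exists a => //; exists 0;
         [exists 0 => //; rewrite scale0r | rewrite addr0].
    move=> h; apply: nAx; apply: h; exists 0; first by case: sA.
    by exists x; [exists 1 => //; rewrite scale1r | rewrite add0r].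
  left; split.
    apply: subspace_sumset => //; split; first by exists 0 => //; rewrite scale0r.
    move=> a _ _ [c _ <-] [d _ <-]; exists (a * c + d) => //.
    by rewrite scalerDl scalerA.
  move=> [a Aa [_ [c _ <-] hv]].
  have c0 : c != 0.
    by apply/negP => /eqP c0; apply: Av; rewrite -hv c0 scale0r addr0.
  apply: nx; exists c^-1; rewrite -hv scalerDr scalerA mulVf // scale1r.
  by rewrite opprD addrCA subrr addr0; apply: subspaceN => //; apply: subspaceZ.
have uniq x c d : A (x - c *: v) -> A (x - d *: v) -> c = d.
  move=> h1 h2; apply/eqP; rewrite -subr_eq0; apply: contrapT => /negP cd.
  apply: Av; have := subspaceZ (c - d)^-1 sA (subspaceB sA h2 h1).
  by rewrite opprB [X in _ *: X]addrC addrA subrK -scalerBl scalerA mulVf ?scale1r.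
pose f x := sval (cid (ex x)).
have fP x : A (x - f x *: v) by rewrite /f; case: cid.
exists f; split; last by apply: (uniq v) => //; rewrite scale1r subrr; case: sA.
move=> a x y; apply: (uniq (a *: x + y)) => //.
have := sA.2 a _ _ (fP x) (fP y).
by rewrite scalerBr scalerA addrACA -opprD scalerDl.
Qed.

End Subspaces.

(* U ⊗ V is the set of formal sums of pairs, two of them being identified when *)
(* every bilinear map sums them to the same value.                             *)
Section Tensor.
Variables (k : fieldType) (U V : lmodType k).

Definition bilinear_fun (W : lmodType k) (f : U -> V -> W) : Prop :=
  (forall v, linear (f^~ v)) /\ (forall u, linear (f u)).

Definition formal_eval (W : lmodType k) (f : U -> V -> W) (s : seq (U * V)) : W :=
  \sum_(p <- s) f p.1 p.2.

Definition tensor_eqv (s t : seq (U * V)) : Prop :=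
  forall (W : lmodType k) (f : U -> V -> W),
    bilinear_fun f -> formal_eval f s = formal_eval f t.

Definition tensor_rel (s t : seq (U * V)) : bool := `[< tensor_eqv s t >].

Lemma tensor_rel_refl : reflexive tensor_rel.
Proof. by move=> s; apply/asboolP. Qed.

Lemma tensor_rel_sym : symmetric tensor_rel.
Proof.
by move=> s t; apply/asboolP/asboolP => h W f bf; rewrite (h W f bf).
Qed.

Lemma tensor_rel_trans : transitive tensor_rel.
Proof.
move=> t s r /asboolP h1 /asboolP h2; apply/asboolP => W f bf.
by rewrite (h1 W f bf) (h2 W f bf).
Qed.

Canonical tensor_equiv :=
  EquivRel tensor_rel tensor_rel_refl tensor_rel_sym tensor_rel_trans.

Definition tensor : Type := {eq_quot tensor_equiv}.
HB.instance Definition _ := Choice.on tensor.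
HB.instance Definition _ := EqQuotient.on tensor.

Definition tlift (W : lmodType k) (f : U -> V -> W) (t : tensor) : W :=
  formal_eval f (repr t).

Lemma tlift_pi (W : lmodType k) (f : U -> V -> W) s :
  bilinear_fun f -> tlift f (\pi_tensor s) = formal_eval f s.
Proof.
move=> bf; have /eqP := reprK (\pi_tensor s).
by rewrite eqmodE => /asboolP /(_ W f bf).
Qed.

Lemma tensor_eqP (x y : tensor) :
  (forall (W : lmodType k) (f : U -> V -> W), bilinear_fun f ->
     tlift f x = tlift f y) -> x = y.
Proof.
move=> h; rewrite -[x]reprK -[y]reprK; apply/eqP; rewrite eqmodE.
by apply/asboolP.
Qed.

Definition tens (u : U) (v : V) : tensor := \pi_tensor [:: (u, v)].
Definition tadd (x y : tensor) : tensor := \pi_tensor (repr x ++ repr y).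
Definition tzero : tensor := \pi_tensor [::].
Definition tscale (a : k) (x : tensor) : tensor :=
  \pi_tensor [seq (a *: p.1, p.2) | p <- repr x].
Definition topp (x : tensor) : tensor := tscale (-1) x.

Section Eval.
Variables (W : lmodType k) (f : U -> V -> W).
Hypothesis bf : bilinear_fun f.

Lemma bilinearDl u u' v : f (u + u') v = f u v + f u' v.
Proof. by have := bf.1 v 1 u u'; rewrite !scale1r. Qed.
Lemma bilinearDr u v v' : f u (v + v') = f u v + f u v'.
Proof. by have := bf.2 u 1 v v'; rewrite !scale1r. Qed.
Lemma bilinear0l v : f 0 v = 0.
Proof. by apply: (addIr (f 0 v)); rewrite -bilinearDl !add0r. Qed.
Lemma bilinear0r u : f u 0 = 0.
Proof. by apply: (addIr (f u 0)); rewrite -bilinearDr !add0r. Qed.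
Lemma bilinearZl a u v : f (a *: u) v = a *: f u v.
Proof. by have := bf.1 v a u 0; rewrite !addr0 bilinear0l addr0. Qed.
Lemma bilinearZr a u v : f u (a *: v) = a *: f u v.
Proof. by have := bf.2 u a v 0; rewrite !addr0 bilinear0r addr0. Qed.

Lemma tlift_tens u v : tlift f (tens u v) = f u v.
Proof. by rewrite tlift_pi // /formal_eval big_seq1. Qed.
Lemma tlift_add x y : tlift f (tadd x y) = tlift f x + tlift f y.
Proof. by rewrite tlift_pi // /formal_eval big_cat. Qed.
Lemma tlift_zero : tlift f tzero = 0.
Proof. by rewrite tlift_pi // /formal_eval big_nil. Qed.
Lemma tlift_scale a x : tlift f (tscale a x) = a *: tlift f x.
Proof.
rewrite tlift_pi // /formal_eval big_map scaler_sumr.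
by apply: eq_bigr => p _; rewrite bilinearZl.
Qed.
End Eval.

Lemma taddA : associative tadd.
Proof.
by move=> x y z; apply: tensor_eqP => W f bf; rewrite !tlift_add // addrA.
Qed.
Lemma taddC : commutative tadd.
Proof.
by move=> x y; apply: tensor_eqP => W f bf; rewrite !tlift_add // addrC.
Qed.
Lemma tadd0 : left_id tzero tadd.
Proof.
by move=> x; apply: tensor_eqP => W f bf; rewrite tlift_add // tlift_zero // add0r.
Qed.
Lemma taddN : left_inverse tzero topp tadd.
Proof.
move=> x; apply: tensor_eqP => W f bf.
by rewrite tlift_add // tlift_scale // tlift_zero // scaleN1r addNr.
Qed.
HB.instance Definition _ := GRing.isZmodule.Build tensor taddA taddC tadd0 taddN.

Lemma tscaleA a b x : tscale a (tscale b x) = tscale (a * b) x.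
Proof.
by apply: tensor_eqP => W f bf; rewrite !tlift_scale // scalerA.
Qed.
Lemma tscale1 : left_id 1 tscale.
Proof.
by move=> x; apply: tensor_eqP => W f bf; rewrite !tlift_scale // scale1r.
Qed.
Lemma tscaleDr : right_distributive tscale +%R.
Proof.
move=> a x y; apply: tensor_eqP => W f bf.
by rewrite tlift_scale // !tlift_add // !tlift_scale // scalerDr.
Qed.
Lemma tscaleDl x : {morph tscale^~ x : a b / a + b}.
Proof.
move=> a b; apply: tensor_eqP => W f bf.
by rewrite tlift_add // !tlift_scale // scalerDl.
Qed.
HB.instance Definition _ :=
  GRing.Zmodule_isLmodule.Build k tensor tscaleA tscale1 tscaleDr tscaleDl.

Lemma tlift_linear (W : lmodType k) (f : U -> V -> W) :
  bilinear_fun f -> linear (tlift f).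
Proof. by move=> bf a x y; rewrite tlift_add // tlift_scale. Qed.

Lemma tens_bilinear : bilinear_fun tens.
Proof.
by split=> [v|u] a x y; apply: tensor_eqP => W f bf;
   rewrite tlift_add // tlift_scale // !tlift_tens //
     ?(bilinearDl bf, bilinearZl bf, bilinearDr bf, bilinearZr bf).
Qed.

Lemma tensor_sum (x : tensor) : exists s, x = \sum_(p <- s) tens p.1 p.2.
Proof.
exists (repr x); apply: tensor_eqP => W f bf; rewrite {1}/tlift /formal_eval.
elim: (repr x) => [|p s IH]; first by rewrite !big_nil tlift_zero.
by rewrite !big_cons tlift_add // tlift_tens // IH.
Qed.

Lemma tensor_ind (P : tensor -> Prop) :
  P 0 -> (forall x y, P x -> P y -> P (x + y)) -> (forall u v, P (tens u v)) ->
  forall x, P x.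
Proof.
move=> P0 PD Pt x; have [s ->] := tensor_sum x.
by elim: s => [|p s IH]; rewrite ?big_nil ?big_cons //; apply: PD.
Qed.

Lemma tensor_ext (W : lmodType k) (f g : {linear tensor -> W}) :
  (forall u v, f (tens u v) = g (tens u v)) -> f =1 g.
Proof.
by move=> h; apply: tensor_ind => [|x y hx hy|//]; rewrite ?linear0 // !linearD hx hy.
Qed.

End Tensor.

Notation "U ⊗ V" := (tensor U%type V%type) (at level 38, right associativity) : type_scope.
Notation "u ⊗ v" := (tens u v) (at level 38, right associativity) : ring_scope.

Section TensorMaps.
Variable k : fieldType.

Lemma tlift_comb (U V W : lmodType k) (f g h : U -> V -> W) (a : k) t :
  (forall u v, h u v = a *: f u v + g u v) ->
  tlift h t = a *: tlift f t + tlift g t.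
Proof.
move=> e; rewrite /tlift /formal_eval scaler_sumr -big_split.
by apply: eq_bigr => p _; rewrite e.
Qed.

Lemma eq_tlift (U V W : lmodType k) (f g : U -> V -> W) t :
  (forall u v, f u v = g u v) -> tlift f t = tlift g t.
Proof. by move=> e; apply: eq_bigr => p _; rewrite e. Qed.

Lemma linear_tlift (U V W X : lmodType k) (h : {linear W -> X})
    (f : U -> V -> W) t :
  h (tlift f t) = tlift (fun u v => h (f u v)) t.
Proof. by rewrite /tlift /formal_eval linear_sum. Qed.

Section Tmap.
Variables U V U' V' : lmodType k.

Definition tmap (f : U -> U') (g : V -> V') : U ⊗ V -> U' ⊗ V' :=
  tlift (fun u v => f u ⊗ g v).

Variables (f : {linear U -> U'}) (g : {linear V -> V'}).

Lemma tmap_bilinear : bilinear_fun (fun u v => f u ⊗ g v).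
Proof.
by split=> [v|u] a x y; rewrite linearP;
   [rewrite (tens_bilinear _ _).1 | rewrite (tens_bilinear _ _).2].
Qed.

Lemma tmap_linear : linear (tmap f g).
Proof. exact: tlift_linear tmap_bilinear. Qed.

HB.instance Definition _ :=
  GRing.isLinear.Build k (U ⊗ V)%type (U' ⊗ V')%type *:%R (tmap f g) tmap_linear.

Lemma tmapE u v : tmap f g (u ⊗ v) = f u ⊗ g v.
Proof. exact: (tlift_tens tmap_bilinear). Qed.

End Tmap.

Section Tassoc.
Variables U V W : lmodType k.

Definition tassoc : (U ⊗ V) ⊗ W -> U ⊗ (V ⊗ W) :=
  tlift (fun (t : U ⊗ V) (w : W) => tlift (fun u v => u ⊗ (v ⊗ w)) t).

Lemma tassoc_bilinear_in (w : W) : bilinear_fun (fun (u : U) (v : V) => u ⊗ (v ⊗ w)).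
Proof.
split=> [v|u] a x y; first by rewrite (tens_bilinear _ _).1.
by rewrite (tens_bilinear _ _).1 (tens_bilinear _ _).2.
Qed.

Lemma tassoc_bilinear :
  bilinear_fun (fun (t : U ⊗ V) (w : W) => tlift (fun u v => u ⊗ (v ⊗ w)) t).
Proof.
split=> [w|t] a x y; first by rewrite (tlift_linear (tassoc_bilinear_in w)).
by apply: tlift_comb => u v; rewrite (tens_bilinear _ _).2 (tens_bilinear _ _).2.
Qed.

Lemma tassoc_linear : linear tassoc.
Proof. exact: tlift_linear tassoc_bilinear. Qed.

HB.instance Definition _ :=
  GRing.isLinear.Build k ((U ⊗ V) ⊗ W)%type (U ⊗ (V ⊗ W))%type *:%R tassoc tassoc_linear.

Lemma tassocE u v w : tassoc ((u ⊗ v) ⊗ w) = u ⊗ (v ⊗ w).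
Proof.
by rewrite /tassoc (tlift_tens tassoc_bilinear) (tlift_tens (tassoc_bilinear_in w)).
Qed.

End Tassoc.

Definition tlift3 (U V W X : lmodType k) (f : U -> V -> W -> X)
    (t : U ⊗ (V ⊗ W)) : X :=
  tlift (fun u s => tlift (f u) s) t.

Definition trilinear_fun (U V W X : lmodType k) (f : U -> V -> W -> X) : Prop :=
  (forall v w, linear (fun u => f u v w)) /\ (forall u, bilinear_fun (f u)).

Lemma trilinear_tlift (U V W X : lmodType k) (f : U -> V -> W -> X) :
  trilinear_fun f -> bilinear_fun (fun u s => tlift (f u) s).
Proof.
move=> [h1 h2]; split=> [s|u]; last exact: tlift_linear (h2 u).
by move=> a x y; apply: tlift_comb => v w; rewrite h1.
Qed.

Lemma tlift3_linear (U V W X : lmodType k) (f : U -> V -> W -> X) :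
  trilinear_fun f -> linear (tlift3 f).
Proof. by move=> tf; apply: tlift_linear; apply: trilinear_tlift. Qed.

Lemma tlift3E (U V W X : lmodType k) (f : U -> V -> W -> X) u v w :
  trilinear_fun f -> tlift3 f (u ⊗ (v ⊗ w)) = f u v w.
Proof.
move=> tf; rewrite /tlift3 (tlift_tens (trilinear_tlift tf)).
by case: tf => _ h; rewrite (tlift_tens (h u)).
Qed.

(* The span of the u ⊗ v with u in A and v in B, a copy of A ⊗ B inside U ⊗ V  *)
(* as k is a field.                                                            *)
Definition tensor_sub (U V : lmodType k) (A : set U) (B : set V) : set (U ⊗ V) :=
  lspan [set u ⊗ v | u in A & v in B].

End TensorMaps.
Arguments tassoc {k U V W}.

Section TensorAlgebra.
Variables (k : fieldType) (A B : algType k).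

Definition tmul (x y : A ⊗ B) : A ⊗ B :=
  tlift (fun a b => tlift (fun a' b' => (a * a') ⊗ (b * b')) y) x.

Let tmul_in a b : bilinear_fun (fun (a' : A) (b' : B) => (a * a') ⊗ (b * b')).
Proof.
by split=> [v|u] c x y; rewrite mulrDr -scalerAr;
   [rewrite (tens_bilinear _ _).1 | rewrite (tens_bilinear _ _).2].
Qed.

Let tmul_out y : bilinear_fun
  (fun (a : A) (b : B) => tlift (fun a' b' => (a * a') ⊗ (b * b')) y).
Proof.
split=> [b|a] c u v; apply: tlift_comb => a' b'; rewrite mulrDl -scalerAl;
   [by rewrite (tens_bilinear _ _).1 | by rewrite (tens_bilinear _ _).2].
Qed.

Lemma tmulE a b a' b' : tmul (a ⊗ b) (a' ⊗ b') = (a * a') ⊗ (b * b').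
Proof. by rewrite /tmul (tlift_tens (tmul_out _)) (tlift_tens (tmul_in _ _)). Qed.

Lemma tmul_linl y : linear (tmul^~ y).
Proof. exact: tlift_linear (tmul_out y). Qed.

Lemma tmul_linr x : linear (tmul x).
Proof.
move=> c y z; apply: tlift_comb => a b.
by rewrite (tlift_linear (tmul_in a b)).
Qed.

Let linD (U V : lmodType k) (f : U -> V) : linear f -> {morph f : x y / x + y}.
Proof. by move=> h x y; have := h 1 x y; rewrite !scale1r. Qed.
Let lin0 (U V : lmodType k) (f : U -> V) : linear f -> f 0 = 0.
Proof. by move=> h; apply: (addIr (f 0)); rewrite -linD // !add0r. Qed.
Let linZ (U V : lmodType k) (f : U -> V) : linear f -> forall a x, f (a *: x) = a *: f x.
Proof. by move=> h a x; have := h a x 0; rewrite !addr0 (lin0 h) addr0. Qed.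

Lemma tmulDl : left_distributive tmul +%R.
Proof. by move=> x y z; apply: (linD (tmul_linl z)). Qed.
Lemma tmulDr : right_distributive tmul +%R.
Proof. by move=> x y z; apply: (linD (tmul_linr x)). Qed.
Let tmul0 x : tmul x 0 = 0. Proof. exact: (lin0 (tmul_linr x)). Qed.
Let t0mul x : tmul 0 x = 0. Proof. exact: (lin0 (tmul_linl x)). Qed.

Lemma tmulA : associative tmul.
Proof.
move=> x y z; elim/tensor_ind: x => [|x x' h h'|a b]; first by rewrite !t0mul.
  by rewrite !tmulDl h h'.
elim/tensor_ind: y => [|y y' h h'|a' b']; first by rewrite t0mul !tmul0 t0mul.
  by rewrite tmulDl !tmulDr tmulDl h h'.
elim/tensor_ind: z => [|z z' h h'|a'' b'']; first by rewrite !tmul0.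
  by rewrite !tmulDr h h'.
by rewrite !tmulE !mulrA.
Qed.

Lemma tmul1 : left_id (1 ⊗ 1) tmul.
Proof.
move=> x; elim/tensor_ind: x => [|x x' h h'|a b]; first by rewrite !tmul0.
  by rewrite tmulDr h h'.
by rewrite tmulE !mul1r.
Qed.

Lemma t1mul : right_id (1 ⊗ 1) tmul.
Proof.
move=> x; elim/tensor_ind: x => [|x x' h h'|a b]; first by rewrite !t0mul.
  by rewrite tmulDl h h'.
by rewrite tmulE !mulr1.
Qed.

Lemma tens11_neq0 : (1 : A) ⊗ (1 : B) != 0.
Proof.
have [f [lf f1]] := separating_functional (oner_neq0 A).
have [g [lg g1]] := separating_functional (oner_neq0 B).
have bf : bilinear_fun (fun a b => (f a * g b : k^o)).
  split=> [b|a] c x y.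
    by rewrite lf mulrDl -scalerAl.
  by rewrite lg mulrDr -scalerAr.
apply/eqP => /(congr1 (tlift (fun a b => (f a * g b : k^o)))).
rewrite (tlift_tens bf) (lin0 (tlift_linear bf)) f1 g1 mulr1.
by apply/eqP; rewrite oner_neq0.
Qed.

HB.instance Definition _ := GRing.Zmodule_isNzRing.Build (A ⊗ B)%type
  tmulA tmul1 t1mul tmulDl tmulDr tens11_neq0.

Lemma tens1 : (1 : A ⊗ B) = 1 ⊗ 1. Proof. by []. Qed.
Lemma tensM a b a' b' : (a ⊗ b : A ⊗ B) * (a' ⊗ b') = (a * a') ⊗ (b * b').
Proof. exact: tmulE. Qed.

Lemma tscalerAl (c : k) (x y : A ⊗ B) : c *: (x * y) = (c *: x) * y.
Proof. by rewrite -(linZ (tmul_linl y)). Qed.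
HB.instance Definition _ := GRing.Lmodule_isLalgebra.Build k (A ⊗ B)%type tscalerAl.
Lemma tscalerAr (c : k) (x y : A ⊗ B) : c *: (x * y) = x * (c *: y).
Proof. by rewrite -(linZ (tmul_linr x)). Qed.
HB.instance Definition _ := GRing.Lalgebra_isAlgebra.Build k (A ⊗ B)%type tscalerAr.

End TensorAlgebra.

Section TensorFunctoriality.
Variable k : fieldType.

Lemma tlift_tmap (U V U' V' W : lmodType k) (p : {linear U -> U'})
    (q : {linear V -> V'}) (f : U' -> V' -> W) t :
  bilinear_fun f -> tlift f (tmap p q t) = tlift (fun u v => f (p u) (q v)) t.
Proof.
move=> bf; rewrite [tmap p q t]/tlift /formal_eval /tlift.
rewrite -/(tlift f _) [RHS]/formal_eval.
elim: (repr t) => [|x s IH]; first by rewrite !big_nil (tlift_zero bf).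
by rewrite !big_cons (tlift_add bf) (tlift_tens bf) IH.
Qed.

Lemma tmap_comp (U V U' V' U'' V'' : lmodType k)
    (f' : {linear U' -> U''}) (g' : {linear V' -> V''})
    (f : {linear U -> U'}) (g : {linear V -> V'}) t :
  tmap f' g' (tmap f g t) = tmap (f' \o f) (g' \o g) t.
Proof. by rewrite [LHS](tlift_tmap _ _ _ (tmap_bilinear f' g')). Qed.

Lemma eq_tmap (U V U' V' : lmodType k) (f f' : U -> U') (g g' : V -> V') t :
  f =1 f' -> g =1 g' -> tmap f g t = tmap f' g' t.
Proof. by move=> ef eg; apply: eq_tlift => u v; rewrite ef eg. Qed.

Lemma tassoc_tmap (U V W U' V' W' : lmodType k) (f : {linear U -> U'})
    (g : {linear V -> V'}) (h : {linear W -> W'}) t :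
  tassoc (tmap (tmap f g) h t) = tmap f (tmap g h) (tassoc t).
Proof.
elim/tensor_ind: t => [|x y hx hy|s w]; first by rewrite !linear0.
  by rewrite !linearD /= hx hy.
rewrite tmapE /=; elim/tensor_ind: s => [|x y hx hy|u v].
- have z (X Y : lmodType k) (y : Y) : (0 : X) ⊗ y = 0.
    exact: (bilinear0l (tens_bilinear X Y)).
  by rewrite linear0 !z !linear0.
- have d (X Y : lmodType k) (a b : X) (y' : Y) : (a + b) ⊗ y' = a ⊗ y' + b ⊗ y'.
    exact: (bilinearDl (tens_bilinear X Y)).
  by rewrite linearD !d !linearD /= hx hy.
- by rewrite tmapE !tassocE tmapE /= tmapE.
Qed.

Lemma tensor_sub_map (U V U' V' : lmodType k) (f : {linear U -> U'})
    (g : {linear V -> V'}) (A : set U) (B : set V) (T : set (U' ⊗ V')) t :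
  subspace T -> (forall u v, A u -> B v -> T (f u ⊗ g v)) ->
  tensor_sub A B t -> T (tmap f g t).
Proof.
move=> sT h; apply: (@lspan_sub _ _ _ [set s | T (tmap f g s)]).
  split=> /= [|a x y hx hy]; first by rewrite linear0; case: sT.
  by rewrite linearP; case: sT => _; apply.
by move=> _ [u Au [v Bv <-]] /=; rewrite tmapE; apply: h.
Qed.

Variables (A B A' B' : algType k).
Variables (f : {lrmorphism A -> A'}) (g : {lrmorphism B -> B'}).

Lemma tmap_monoid_morphism : monoid_morphism (tmap f g).
Proof.
split; first by rewrite tens1 tmapE !rmorph1.
move=> x y; elim/tensor_ind: x => [|x x' h h'|a b].
- by rewrite mul0r !linear0 mul0r.
- by rewrite mulrDl !linearD /= mulrDl h h'.
elim/tensor_ind: y => [|y y' h h'|a' b'].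
- by rewrite mulr0 !linear0 mulr0.
- by rewrite mulrDr !linearD /= mulrDr h h'.
by rewrite tensM !tmapE tensM !rmorphM.
Qed.

HB.instance Definition _ := GRing.isMonoidMorphism.Build
  (A ⊗ B)%type (A' ⊗ B')%type (tmap f g) tmap_monoid_morphism.

End TensorFunctoriality.

Section TensOne.
Variables (k : fieldType) (U : lmodType k) (B : algType k).

Definition tens_one (u : U) : U ⊗ B := u ⊗ 1.

Lemma tens_one_linear : linear tens_one.
Proof. exact: (tens_bilinear U B).1. Qed.

HB.instance Definition _ :=
  GRing.isLinear.Build k U (U ⊗ B)%type *:%R tens_one tens_one_linear.

End TensOne.
Arguments tens_one {k U B}.

(* H^{⊗3} and H^{⊗4} are H ⊗ (H ⊗ H) and H ⊗ (H ⊗ (H ⊗ H)), and tassoc is      *)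
(* inserted where a formula produces another bracketing.                       *)
Record quasiHopf (k : fieldType) (H : algType k) := QuasiHopf {
  Delta : {lrmorphism H -> (H ⊗ H)%type};
  eps : {lrmorphism H -> k | *%R};
  Phi : H ⊗ (H ⊗ H);
  PhiV : H ⊗ (H ⊗ H);
  antipode : {linear H -> H};
  alpha : H;
  beta : H;
  qh_PhiK : Phi * PhiV = 1;
  qh_PhiVK : PhiV * Phi = 1;
  qh_antipode1 : antipode 1 = 1;
  qh_antipodeM : forall x y : H, antipode (x * y) = antipode y * antipode x;
  qh_pentagon :
    (1 ⊗ Phi) * tmap idfun (tassoc \o tmap Delta idfun) Phi
      * tmap idfun (tmap idfun tens_one) Phi
    = tmap idfun (tmap idfun Delta) Phi * tassoc (tmap Delta idfun Phi);
  qh_coassoc : forall x,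
    Phi * tassoc (tmap Delta idfun (Delta x)) = tmap idfun Delta (Delta x) * Phi;
  qh_eps_Phi : tmap idfun (tlift (fun y z => eps y *: z)) Phi = 1 ⊗ 1;
  qh_counitr : forall x, tlift (fun a b => eps b *: a) (Delta x) = x;
  qh_counitl : forall x, tlift (fun a b => eps a *: b) (Delta x) = x;
  qh_alphaP : forall x,
    tlift (fun a b => antipode a * alpha * b) (Delta x) = eps x *: alpha;
  qh_betaP : forall x,
    tlift (fun a b => a * beta * antipode b) (Delta x) = eps x *: beta;
  qh_zigzag :
    tlift3 (fun a b c => a * beta * antipode b * alpha * c) Phi = 1;
  qh_zagzig :
    tlift3 (fun a b c => antipode a * alpha * b * beta * antipode c) PhiV = 1;
  qh_eps_alpha : eps alpha = 1;
  qh_eps_beta : eps beta = 1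
}.

Definition grouplike (k : fieldType) (H : algType k) (Q : quasiHopf H) (x : H) :
  Prop := Delta Q x = x ⊗ x /\ eps Q x = 1.

Record qh_morphism (k : fieldType) (H K : algType k) (Q : quasiHopf H)
    (P : quasiHopf K) (f : {lrmorphism H -> K}) : Prop := QhMorphism {
  qhm_Delta : forall x, Delta P (f x) = tmap f f (Delta Q x);
  qhm_eps : forall x, eps P (f x) = eps Q x;
  qhm_antipode : forall x, antipode P (f x) = f (antipode Q x);
  qhm_Phi : Phi P = tmap f (tmap f f) (Phi Q);
  qhm_alpha : alpha P = f (alpha Q);
  qhm_beta : beta P = f (beta Q)
}.

(* I is a quasi-Hopf ideal of the quasi-Hopf subalgebra A of H; A = setT gives *)
(* the quasi-Hopf ideals of H.                                                 *)
Record qh_ideal (k : fieldType) (H : algType k) (Q : quasiHopf H) (A I : set H) :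
    Prop := QhIdealProp {
  qhi_subspace : subspace I;
  qhi_sub : I `<=` A;
  qhi_mull : forall a x, A a -> I x -> I (a * x);
  qhi_mulr : forall a x, A a -> I x -> I (x * a);
  qhi_Delta : forall x, I x ->
    sumset (tensor_sub I A) (tensor_sub A I) (Delta Q x);
  qhi_eps : forall x, I x -> eps Q x = 0;
  qhi_antipode : forall x, I x -> I (antipode Q x)
}.

Record qhIdeal (k : fieldType) (H : algType k) (Q : quasiHopf H) := QhIdeal {
  qhideal_set :> set H;
  qhidealP : qh_ideal Q setT qhideal_set
}.

Section EpsMaps.
Variables (k : fieldType) (K : algType k) (e : {lrmorphism K -> k | *%R}).

Lemma scale_epsl_bilinear :
  bilinear_fun (fun a b : K => e a *: b).
Proof.
by split=> [b|a] c x y; [rewrite linearP scalerDl scalerA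
  | rewrite scalerDr !scalerA mulrC].
Qed.

Lemma scale_epsr_bilinear :
  bilinear_fun (fun a b : K => e b *: a).
Proof.
by split=> [b|a] c x y; [rewrite scalerDr !scalerA mulrC
  | rewrite linearP scalerDl scalerA].
Qed.

Definition tlift_eps : K ⊗ K -> K := tlift (fun a b : K => e a *: b).

Lemma tlift_eps_linear : linear tlift_eps.
Proof. exact: tlift_linear scale_epsl_bilinear. Qed.

HB.instance Definition _ :=
  GRing.isLinear.Build k (K ⊗ K)%type K *:%R tlift_eps tlift_eps_linear.

End EpsMaps.

Section Quotient.
Variables (k : fieldType) (H : algType k) (Q : quasiHopf H) (I : qhIdeal Q).

Let sI : subspace I := qhi_subspace (qhidealP I).

Definition quot_rel (x y : H) : bool := `[< (I : set H) (x - y) >].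

Lemma quot_rel_refl : reflexive quot_rel.
Proof. by move=> x; apply/asboolP; rewrite subrr; case: sI. Qed.

Lemma quot_rel_sym : symmetric quot_rel.
Proof.
by move=> x y; apply/asboolP/asboolP => h; rewrite -opprB; apply: subspaceN.
Qed.

Lemma quot_rel_trans : transitive quot_rel.
Proof.
move=> y x z /asboolP h1 /asboolP h2; apply/asboolP.
by rewrite -(subrK y x) -addrA; apply: subspaceD.
Qed.

Canonical quot_equiv :=
  EquivRel quot_rel quot_rel_refl quot_rel_sym quot_rel_trans.

Definition quot : Type := {eq_quot quot_equiv}.
HB.instance Definition _ := Choice.on quot.
HB.instance Definition _ := EqQuotient.on quot.

Definition qproj (x : H) : quot := \pi_quot x.

Lemma qproj_eq x y : qproj x = qproj y <-> (I : set H) (x - y).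
Proof.
by split=> [/eqP|h]; [rewrite eqmodE => /asboolP | apply/eqP; rewrite eqmodE; apply/asboolP].
Qed.

Lemma qprojK (y : quot) : qproj (repr y) = y.
Proof. exact: reprK. Qed.

Lemma quot_ind (P : quot -> Prop) : (forall x, P (qproj x)) -> forall y, P y.
Proof. by move=> h y; rewrite -(qprojK y). Qed.

Lemma repr_qproj x : (I : set H) (repr (qproj x) - x).
Proof. by apply/qproj_eq; rewrite qprojK. Qed.

Definition quot_add (x y : quot) := qproj (repr x + repr y).
Definition quot_opp (x : quot) := qproj (- repr x).
Definition quot_scale (a : k) (x : quot) := qproj (a *: repr x).
Definition quot_mul (x y : quot) := qproj (repr x * repr y).

Lemma quot_addE x y : quot_add (qproj x) (qproj y) = qproj (x + y).
Proof.
apply/qproj_eq; rewrite opprD addrACA.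
by apply: subspaceD => //; apply: repr_qproj.
Qed.
Lemma quot_oppE x : quot_opp (qproj x) = qproj (- x).
Proof.
by apply/qproj_eq; rewrite -opprD; apply: subspaceN => //; apply: repr_qproj.
Qed.
Lemma quot_scaleE a x : quot_scale a (qproj x) = qproj (a *: x).
Proof.
by apply/qproj_eq; rewrite -scalerBr; apply: subspaceZ => //; apply: repr_qproj.
Qed.
Lemma quot_mulE x y : quot_mul (qproj x) (qproj y) = qproj (x * y).
Proof.
apply/qproj_eq; set x' := repr _; set y' := repr _.
rewrite -(subrK (x' * y) (x' * y')) -addrA -mulrBr -mulrBl.
have [_ _ hl hr _ _ _] := qhidealP I.
by apply: subspaceD => //; [apply: hl | apply: hr] => //; apply: repr_qproj.
Qed.

Lemma quot_addA : associative quot_add.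
Proof.
by elim/quot_ind=> x; elim/quot_ind=> y; elim/quot_ind=> z; rewrite !quot_addE addrA.
Qed.
Lemma quot_addC : commutative quot_add.
Proof. by move=> x y; rewrite /quot_add addrC. Qed.
Lemma quot_add0 : left_id (qproj 0) quot_add.
Proof. by elim/quot_ind=> x; rewrite quot_addE add0r. Qed.
Lemma quot_addN : left_inverse (qproj 0) quot_opp quot_add.
Proof. by elim/quot_ind=> x; rewrite quot_oppE quot_addE addNr. Qed.
HB.instance Definition _ :=
  GRing.isZmodule.Build quot quot_addA quot_addC quot_add0 quot_addN.

Lemma qprojD x y : qproj (x + y) = qproj x + qproj y.
Proof. by rewrite -quot_addE. Qed.

Lemma quot_mulA : associative quot_mul.
Proof.
by elim/quot_ind=> x; elim/quot_ind=> y; elim/quot_ind=> z; rewrite !quot_mulE mulrA.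
Qed.
Lemma quot_mul1 : left_id (qproj 1) quot_mul.
Proof. by elim/quot_ind=> x; rewrite quot_mulE mul1r. Qed.
Lemma quot_1mul : right_id (qproj 1) quot_mul.
Proof. by elim/quot_ind=> x; rewrite quot_mulE mulr1. Qed.
Lemma quot_mulDl : left_distributive quot_mul +%R.
Proof.
elim/quot_ind=> x; elim/quot_ind=> y; elim/quot_ind=> z.
by rewrite -qprojD !quot_mulE -qprojD mulrDl.
Qed.
Lemma quot_mulDr : right_distributive quot_mul +%R.
Proof.
elim/quot_ind=> x; elim/quot_ind=> y; elim/quot_ind=> z.
by rewrite -qprojD !quot_mulE -qprojD mulrDr.
Qed.
Lemma quot_1neq0 : qproj 1 != 0.
Proof.
apply/eqP => /qproj_eq; rewrite subr0 => /(qhi_eps (qhidealP I)).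
by rewrite rmorph1; apply/eqP; rewrite oner_neq0.
Qed.
HB.instance Definition _ := GRing.Zmodule_isNzRing.Build quot
  quot_mulA quot_mul1 quot_1mul quot_mulDl quot_mulDr quot_1neq0.

Lemma quot_scaleA a b x : quot_scale a (quot_scale b x) = quot_scale (a * b) x.
Proof. by elim/quot_ind: x => x; rewrite !quot_scaleE scalerA. Qed.
Lemma quot_scale1 : left_id 1 quot_scale.
Proof. by elim/quot_ind=> x; rewrite quot_scaleE scale1r. Qed.
Lemma quot_scaleDr : right_distributive quot_scale +%R.
Proof.
move=> a; elim/quot_ind=> x; elim/quot_ind=> y.
by rewrite -qprojD !quot_scaleE -qprojD scalerDr.
Qed.
Lemma quot_scaleDl x : {morph quot_scale^~ x : a b / a + b}.
Proof.
by move=> a b; elim/quot_ind: x => x; rewrite !quot_scaleE -qprojD scalerDl.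
Qed.
HB.instance Definition _ := GRing.Zmodule_isLmodule.Build k quot
  quot_scaleA quot_scale1 quot_scaleDr quot_scaleDl.

Lemma qproj_linear : linear qproj.
Proof. by move=> a x y; rewrite qprojD -[RHS]/(quot_scale _ _ + _) quot_scaleE. Qed.
HB.instance Definition _ := GRing.isLinear.Build k H quot *:%R qproj qproj_linear.

Lemma qproj_monoid_morphism : monoid_morphism qproj.
Proof. by split=> // x y; rewrite -[RHS]/(quot_mul _ _) quot_mulE. Qed.
HB.instance Definition _ :=
  GRing.isMonoidMorphism.Build H quot qproj qproj_monoid_morphism.

Lemma quot_scalerAl a (x y : quot) : a *: (x * y) = (a *: x) * y.
Proof.
elim/quot_ind: x => x; elim/quot_ind: y => y.
by rewrite -rmorphM -!linearZ -rmorphM scalerAl.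
Qed.
HB.instance Definition _ := GRing.Lmodule_isLalgebra.Build k quot quot_scalerAl.
Lemma quot_scalerAr a (x y : quot) : a *: (x * y) = x * (a *: y).
Proof.
elim/quot_ind: x => x; elim/quot_ind: y => y.
by rewrite -rmorphM -!linearZ -rmorphM scalerAr.
Qed.
HB.instance Definition _ := GRing.Lalgebra_isAlgebra.Build k quot quot_scalerAr.

Definition quot_lift (W : Type) (f : H -> W) (y : quot) : W := f (repr y).

Lemma quot_liftE (W : lmodType k) (f : {linear H -> W}) x :
  (forall z, (I : set H) z -> f z = 0) -> quot_lift f (qproj x) = f x.
Proof.
by move=> h; apply/eqP; rewrite -subr_eq0 -linearB; apply/eqP/h/repr_qproj.
Qed.

Definition quot_Delta : quot -> quot ⊗ quot :=
  quot_lift (tmap qproj qproj \o Delta Q).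
Definition quot_eps : quot -> k := quot_lift (eps Q).
Definition quot_antipode : quot -> quot := quot_lift (qproj \o antipode Q).

Lemma qproj0 x : (I : set H) x -> qproj x = 0.
Proof. by move=> h; apply/qproj_eq; rewrite subr0. Qed.

Lemma quot_DeltaE x : quot_Delta (qproj x) = tmap qproj qproj (Delta Q x).
Proof.
apply: quot_liftE => z Iz /=; have [_ _ _ _ hD _ _] := qhidealP I.
have sub0 : subspace [set t : quot ⊗ quot | t = 0].
  by split=> // a x' y' /= -> ->; rewrite scaler0 addr0.
have [s hs [t ht <-]] := hD z Iz; rewrite linearD /=.
rewrite (tensor_sub_map (f := qproj) (g := qproj) sub0 _ hs); last first.
  move=> u v Iu _ /=; rewrite (qproj0 Iu).
  exact: (bilinear0l (tens_bilinear _ _)).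
rewrite (tensor_sub_map (f := qproj) (g := qproj) sub0 _ ht) ?addr0 //.
move=> u v _ Iv /=; rewrite (qproj0 Iv).
exact: (bilinear0r (tens_bilinear _ _)).
Qed.

Lemma quot_epsE x : quot_eps (qproj x) = eps Q x.
Proof.
apply/eqP; rewrite -subr_eq0 -[quot_eps _]/(eps Q _) -rmorphB; apply/eqP.
by apply: (qhi_eps (qhidealP I)); apply: repr_qproj.
Qed.

Lemma quot_antipodeE x : quot_antipode (qproj x) = qproj (antipode Q x).
Proof.
apply: quot_liftE => z Iz /=.
by apply: qproj0; apply: (qhi_antipode (qhidealP I)).
Qed.

Lemma quot_Delta_linear : linear quot_Delta.
Proof.
move=> a; elim/quot_ind=> x; elim/quot_ind=> y.
by rewrite -linearP !quot_DeltaE !linearP.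
Qed.
HB.instance Definition _ := GRing.isLinear.Build k quot (quot ⊗ quot)%type *:%R
  quot_Delta quot_Delta_linear.
Lemma quot_Delta_monoid_morphism : monoid_morphism quot_Delta.
Proof.
split; first by rewrite -(rmorph1 qproj) quot_DeltaE !rmorph1.
elim/quot_ind=> x; elim/quot_ind=> y.
by rewrite -rmorphM !quot_DeltaE !rmorphM.
Qed.
HB.instance Definition _ := GRing.isMonoidMorphism.Build quot (quot ⊗ quot)%type
  quot_Delta quot_Delta_monoid_morphism.

Lemma quot_eps_linear : linear_for *%R quot_eps.
Proof.
move=> a; elim/quot_ind=> x; elim/quot_ind=> y.
by rewrite -linearP !quot_epsE !linearP.
Qed.
HB.instance Definition _ := GRing.isLinear.Build k quot k *%R
  quot_eps quot_eps_linear.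
Lemma quot_eps_monoid_morphism : monoid_morphism quot_eps.
Proof.
split; first by rewrite -(rmorph1 qproj) quot_epsE !rmorph1.
elim/quot_ind=> x; elim/quot_ind=> y.
by rewrite -rmorphM !quot_epsE !rmorphM.
Qed.
HB.instance Definition _ := GRing.isMonoidMorphism.Build quot k
  quot_eps quot_eps_monoid_morphism.

Lemma quot_antipode_linear : linear quot_antipode.
Proof.
move=> a; elim/quot_ind=> x; elim/quot_ind=> y.
by rewrite -linearP !quot_antipodeE !linearP.
Qed.
HB.instance Definition _ := GRing.isLinear.Build k quot quot *:%R
  quot_antipode quot_antipode_linear.

Let q3 := tmap qproj (tmap qproj qproj).
Definition quot_Phi : quot ⊗ (quot ⊗ quot) := q3 (Phi Q).
Definition quot_PhiV : quot ⊗ (quot ⊗ quot) := q3 (PhiV Q).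

Lemma quot_PhiK : quot_Phi * quot_PhiV = 1.
Proof. by rewrite -rmorphM qh_PhiK rmorph1. Qed.
Lemma quot_PhiVK : quot_PhiV * quot_Phi = 1.
Proof. by rewrite -rmorphM qh_PhiVK rmorph1. Qed.
Lemma quot_antipode1 : quot_antipode 1 = 1.
Proof. by rewrite -(rmorph1 qproj) quot_antipodeE qh_antipode1. Qed.
Lemma quot_antipodeM x y :
  quot_antipode (x * y) = quot_antipode y * quot_antipode x.
Proof.
elim/quot_ind: x => x; elim/quot_ind: y => y.
by rewrite -rmorphM !quot_antipodeE qh_antipodeM rmorphM.
Qed.

Lemma quot_pentagon :
    (1 ⊗ quot_Phi) * tmap idfun (tassoc \o tmap quot_Delta idfun) quot_Phi
      * tmap idfun (tmap idfun tens_one) quot_Phi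
    = tmap idfun (tmap idfun quot_Delta) quot_Phi
      * tassoc (tmap quot_Delta idfun quot_Phi).
Proof.
pose q4 := tmap qproj q3.
have e1 : (1 : quot) ⊗ quot_Phi = q4 (1 ⊗ Phi Q) by rewrite /q4 tmapE rmorph1.
have e2 : tmap idfun (tassoc \o tmap quot_Delta idfun) quot_Phi
    = q4 (tmap idfun (tassoc \o tmap (Delta Q) idfun) (Phi Q)).
  rewrite /q4 /quot_Phi /q3 !tmap_comp; apply: eq_tmap => // x /=.
  rewrite tmap_comp -tassoc_tmap tmap_comp; congr (tassoc _).
  by apply: eq_tmap => // z /=; rewrite quot_DeltaE.
have e3 : tmap idfun (tmap idfun tens_one) quot_Phi
    = q4 (tmap idfun (tmap idfun tens_one) (Phi Q)).
  rewrite /q4 /quot_Phi /q3 !tmap_comp; apply: eq_tmap => // x /=.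
  rewrite !tmap_comp; apply: eq_tmap => // z /=.
  by rewrite /tens_one tmapE rmorph1.
have e4 : tmap idfun (tmap idfun quot_Delta) quot_Phi
    = q4 (tmap idfun (tmap idfun (Delta Q)) (Phi Q)).
  rewrite /q4 /quot_Phi /q3 !tmap_comp; apply: eq_tmap => // x /=.
  rewrite !tmap_comp; apply: eq_tmap => // z /=.
  by rewrite quot_DeltaE.
have e5 : tassoc (tmap quot_Delta idfun quot_Phi)
    = q4 (tassoc (tmap (Delta Q) idfun (Phi Q))).
  rewrite /q4 /quot_Phi /q3 -tassoc_tmap !tmap_comp; congr (tassoc _).
  by apply: eq_tmap => // x /=; rewrite quot_DeltaE.
by rewrite e1 e2 e3 e4 e5 -!rmorphM qh_pentagon.
Qed.

Lemma quot_coassoc x :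
  quot_Phi * tassoc (tmap quot_Delta idfun (quot_Delta x))
  = tmap idfun quot_Delta (quot_Delta x) * quot_Phi.
Proof.
elim/quot_ind: x => x; rewrite quot_DeltaE.
have e1 : tassoc (tmap quot_Delta idfun (tmap qproj qproj (Delta Q x)))
    = q3 (tassoc (tmap (Delta Q) idfun (Delta Q x))).
  rewrite /q3 -tassoc_tmap !tmap_comp; congr (tassoc _).
  by apply: eq_tmap => // z /=; rewrite quot_DeltaE.
have e2 : tmap idfun quot_Delta (tmap qproj qproj (Delta Q x))
    = q3 (tmap idfun (Delta Q) (Delta Q x)).
  rewrite /q3 !tmap_comp.
  by apply: eq_tmap => // z /=; rewrite quot_DeltaE.
by rewrite e1 e2 -!rmorphM qh_coassoc.
Qed.

Lemma quot_eps_Phi :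
  tmap idfun (tlift (fun y z => quot_eps y *: z)) quot_Phi = 1 ⊗ 1.
Proof.
rewrite -[RHS](rmorph1 (tmap qproj qproj)) tens1 -(qh_eps_Phi Q).
change (tmap idfun (tlift_eps quot_eps) quot_Phi
  = tmap qproj qproj (tmap idfun (tlift_eps (eps Q)) (Phi Q))).
rewrite /quot_Phi /q3 !tmap_comp; apply: eq_tmap => // t /=.
rewrite /tlift_eps tlift_tmap; last exact: scale_epsl_bilinear.
rewrite linear_tlift; apply: eq_tlift => u v.
by rewrite linearZ; congr (_ *: _); exact: quot_epsE.
Qed.

Lemma quot_counitr x : tlift (fun a b => quot_eps b *: a) (quot_Delta x) = x.
Proof.
elim/quot_ind: x => x; rewrite quot_DeltaE tlift_tmap; last exact: scale_epsr_bilinear.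
rewrite -[in RHS](qh_counitr Q x) linear_tlift; apply: eq_tlift => u v.
by rewrite linearZ; congr (_ *: _); exact: quot_epsE.
Qed.

Lemma quot_counitl x : tlift (fun a b => quot_eps a *: b) (quot_Delta x) = x.
Proof.
elim/quot_ind: x => x; rewrite quot_DeltaE tlift_tmap; last exact: scale_epsl_bilinear.
rewrite -[in RHS](qh_counitl Q x) linear_tlift; apply: eq_tlift => u v.
by rewrite linearZ; congr (_ *: _); exact: quot_epsE.
Qed.

Lemma quot_alphaP x :
  tlift (fun a b => quot_antipode a * qproj (alpha Q) * b) (quot_Delta x)
  = quot_eps x *: qproj (alpha Q).
Proof.
elim/quot_ind: x => x; rewrite quot_DeltaE tlift_tmap; last first.
  by split=> [b|a] c u v; rewrite ?linearP ?mulrDr ?mulrDl -?scalerAl -?scalerAr.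
rewrite quot_epsE -linearZ -qh_alphaP linear_tlift; apply: eq_tlift => u v.
by rewrite !rmorphM quot_antipodeE.
Qed.

Lemma quot_betaP x :
  tlift (fun a b => a * qproj (beta Q) * quot_antipode b) (quot_Delta x)
  = quot_eps x *: qproj (beta Q).
Proof.
elim/quot_ind: x => x; rewrite quot_DeltaE tlift_tmap; last first.
  by split=> [b|a] c u v; rewrite ?linearP ?mulrDr ?mulrDl -?scalerAl -?scalerAr.
rewrite quot_epsE -linearZ -qh_betaP linear_tlift; apply: eq_tlift => u v.
by rewrite !rmorphM quot_antipodeE.
Qed.

Let lin_simp := (mulrDr, mulrDl).

Lemma quot_zigzag :
  tlift3 (fun a b c => a * qproj (beta Q) * quot_antipode b * qproj (alpha Q) * c)
    quot_Phi = 1.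
Proof.
have tf : trilinear_fun (fun a b c : quot =>
    a * qproj (beta Q) * quot_antipode b * qproj (alpha Q) * c).
  by split=> [v w|u]; [|split=> [v|w]] => c x y;
     rewrite ?linearP ?lin_simp -?(scalerAl, scalerAr) ?lin_simp -?(scalerAl, scalerAr).
rewrite -(rmorph1 qproj) -(qh_zigzag Q) /tlift3 [RHS](linear_tlift qproj) /quot_Phi /q3.
rewrite tlift_tmap; last exact: trilinear_tlift.
apply: eq_tlift => u s; rewrite tlift_tmap; last exact: tf.2.
rewrite linear_tlift; apply: eq_tlift => v w.
by rewrite !rmorphM quot_antipodeE.
Qed.

Lemma quot_zagzig :
  tlift3 (fun a b c =>
      quot_antipode a * qproj (alpha Q) * b * qproj (beta Q) * quot_antipode c)
    quot_PhiV = 1.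
Proof.
have tf : trilinear_fun (fun a b c : quot =>
    quot_antipode a * qproj (alpha Q) * b * qproj (beta Q) * quot_antipode c).
  by split=> [v w|u]; [|split=> [v|w]] => c x y;
     rewrite ?linearP ?lin_simp -?(scalerAl, scalerAr) ?lin_simp -?(scalerAl, scalerAr).
rewrite -(rmorph1 qproj) -(qh_zagzig Q) /tlift3 [RHS](linear_tlift qproj) /quot_PhiV /q3.
rewrite tlift_tmap; last exact: trilinear_tlift.
apply: eq_tlift => u s; rewrite tlift_tmap; last exact: tf.2.
rewrite linear_tlift; apply: eq_tlift => v w.
by rewrite !rmorphM !quot_antipodeE.
Qed.

Lemma quot_eps_alpha : quot_eps (qproj (alpha Q)) = 1.
Proof. by rewrite quot_epsE qh_eps_alpha. Qed.
Lemma quot_eps_beta : quot_eps (qproj (beta Q)) = 1.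
Proof. by rewrite quot_epsE qh_eps_beta. Qed.

Definition quot_quasiHopf : quasiHopf quot :=
  @QuasiHopf k quot quot_Delta quot_eps quot_Phi quot_PhiV quot_antipode
    (qproj (alpha Q)) (qproj (beta Q)) quot_PhiK quot_PhiVK
    quot_antipode1 quot_antipodeM quot_pentagon quot_coassoc quot_eps_Phi
    quot_counitr quot_counitl quot_alphaP quot_betaP quot_zigzag quot_zagzig
    quot_eps_alpha quot_eps_beta.

Lemma qproj_morphism : qh_morphism Q quot_quasiHopf qproj.
Proof.
split=> //= x; [exact: quot_DeltaE | exact: quot_epsE | exact: quot_antipodeE].
Qed.

End Quotient.

Definition mulset (k : fieldType) (H : algType k) (A B : set H) : set H :=
  lspan [set a * b | a in A & b in B].

Record grading (k : fieldType) (G : groupType) (H : algType k) (Q : quasiHopf H) :=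
  Grading {
  component :> G -> set H;
  gr_subspace : forall g, subspace (component g);
  gr_decomp : forall x : H, exists c : {fsfun G -> H with 0},
    (forall g, component g (c g)) /\ x = \sum_(g <- finsupp c) c g;
  gr_direct : forall c : {fsfun G -> H with 0},
    (forall g, component g (c g)) -> \sum_(g <- finsupp c) c g = 0 ->
    forall g, c g = 0;
  gr_mul : forall g h x y,
    component g x -> component h y -> component (g * h)%g (x * y);
  gr_Delta : forall g x, component g x ->
    tensor_sub (component g) (component g) (Delta Q x);
  gr_antipode : forall g x, component g x -> component g^-1%g (antipode Q x);
  gr_Phi : tensor_sub (component 1%g) (tensor_sub (component 1%g) (component 1%g))
    (Phi Q);
  gr_alpha : component 1%g (alpha Q);
  gr_beta : component 1%g (beta Q)
}.

Definition normal_subgroup (G : groupType) (N : set G) : Prop :=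
  [/\ N 1%g,
      forall m n, N m -> N n -> N (m * n)%g,
      forall n, N n -> N n^-1%g
    & forall g n, N n -> N (g * n * g^-1)%g].

Section Graded.
Variables (k : fieldType) (G : groupType) (H : algType k) (Q : quasiHopf H).
Variable gr : grading G Q.

Definition faithfully_graded : Prop := forall g, exists2 x, gr g x & x != 0.

Definition decomp (x : H) : {fsfun G -> H with 0} := sval (cid (gr_decomp gr x)).

(* Only the vector space structure of k[G] enters the definition of N_I below. *)
Definition zeta (g : G) : {malg k[G]} := << 1 *g g >>.

Definition grading_map (x : H) : {malg k[G]} :=
  \sum_(g <- finsupp (decomp x)) eps Q (decomp x g) *: zeta g.

Definition ideal_subgroup (I : set H) : set G :=
  [set g | (grading_map @` I) (zeta g - zeta 1%g)].

Definition subgroup_part (N : set G) : set H := lspan (\bigcup_(n in N) gr n).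

Definition G_invariant (J : set H) : Prop :=
  forall g, mulset (gr g) J = mulset J (gr g).

Definition induced_ideal (J : set H) : set H := mulset setT J.

Section InducedIdeal.
Variable J : set H.
Hypothesis hJ : qh_ideal Q (gr 1%g) J.
Hypothesis invJ : G_invariant J.

Lemma sub_induced_ideal : J `<=` induced_ideal J.
Proof.
by move=> x Jx; apply: lspan_mem; exists 1 => //; exists x => //; rewrite mul1r.
Qed.

Lemma induced_ideal_mull a x : induced_ideal J x -> induced_ideal J (a * x).
Proof.
apply: (@lspan_sub _ _ _ [set x | induced_ideal J (a * x)]).
  split=> /= [|c u v hu hv]; first by rewrite mulr0; exact: lspan0.
  by rewrite mulrDr -scalerAr; apply: (subspace_lspan _).2.
move=> _ [h _ [j Jj <-]] /=; rewrite mulrA; apply: lspan_mem.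
by exists (a * h) => //; exists j.
Qed.

Lemma ideal_mul_induced j x : J j -> induced_ideal J (j * x).
Proof.
move=> Jj; have [c [hc ->]] := gr_decomp gr x; rewrite mulr_sumr.
apply: subspace_sum => [|g _]; first exact: subspace_lspan.
have : mulset J (gr g) (j * c g).
  by apply: lspan_mem; exists j => //; exists (c g).
rewrite -invJ; apply: lspan_sub; first exact: subspace_lspan.
by move=> _ [a _ [b Jb <-]]; apply: lspan_mem; exists a => //; exists b.
Qed.

Lemma induced_ideal_mulr a x : induced_ideal J x -> induced_ideal J (x * a).
Proof.
apply: (@lspan_sub _ _ _ [set x | induced_ideal J (x * a)]).
  split=> /= [|c u v hu hv]; first by rewrite mul0r; exact: lspan0.
  by rewrite mulrDl -scalerAl; apply: (subspace_lspan _).2.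
move=> _ [h _ [j Jj <-]] /=; rewrite -mulrA; apply: induced_ideal_mull.
exact: ideal_mul_induced.
Qed.

Lemma induced_ideal_Delta x : induced_ideal J x ->
  sumset (tensor_sub (induced_ideal J) setT) (tensor_sub setT (induced_ideal J))
    (Delta Q x).
Proof.
set T := sumset _ _.
have sT : subspace T by apply: subspace_sumset; apply: subspace_lspan.
have T1 a b : induced_ideal J a -> T (a ⊗ b).
  move=> ha; exists (a ⊗ b); first by apply: lspan_mem; exists a => //; exists b.
  by exists 0; [exact: lspan0 | rewrite addr0].
have T2 a b : induced_ideal J b -> T (a ⊗ b).
  move=> hb; exists 0; last first.
    by exists (a ⊗ b); [apply: lspan_mem; exists a => //; exists b | rewrite add0r].
  by exact: lspan0.
have Tmul s t : T t -> T (s * t).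
  elim/tensor_ind: s => [|s s' h h'|a b] Tt.
  - by rewrite mul0r; case: sT.
  - by rewrite mulrDl; apply: subspaceD => //; [apply: h | apply: h'].
  case: Tt => u hu [v hv <-]; rewrite mulrDr; apply: subspaceD => //.
    move: hu; apply: (@lspan_sub _ _ _ [set u | T ((a ⊗ b) * u)]).
      split=> /= [|c x' y' hx hy]; first by rewrite mulr0; case: sT.
      by rewrite mulrDr -scalerAr; apply: sT.2.
    move=> _ [i Ii [h _ <-]] /=; rewrite tensM; apply: T1.
    exact: induced_ideal_mull.
  move: hv; apply: (@lspan_sub _ _ _ [set u | T ((a ⊗ b) * u)]).
    split=> /= [|c x' y' hx hy]; first by rewrite mulr0; case: sT.
    by rewrite mulrDr -scalerAr; apply: sT.2.
  move=> _ [h _ [i Ii <-]] /=; rewrite tensM; apply: T2.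
  exact: induced_ideal_mull.
apply: (@lspan_sub _ _ _ [set x | T (Delta Q x)]).
  split=> /= [|c u v hu hv]; first by rewrite linear0; case: sT.
  by rewrite linearP; apply: sT.2.
move=> _ [h _ [j Jj <-]] /=.
suff Tj : T (Delta Q j) by rewrite rmorphM; apply: Tmul.
have [u hu [v hv <-]] := qhi_Delta hJ Jj; apply: subspaceD => //.
  move: hu; apply: lspan_sub => // _ [i Ji [b _ <-]].
  by apply: T1; apply: sub_induced_ideal.
move: hv; apply: lspan_sub => // _ [b _ [i Ji <-]].
by apply: T2; apply: sub_induced_ideal.
Qed.

Lemma induced_ideal_qh : qh_ideal Q setT (induced_ideal J).
Proof.
split.
- exact: subspace_lspan.
- by [].
- by move=> a x _; apply: induced_ideal_mull.
- by move=> a x _; apply: induced_ideal_mulr.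
- exact: induced_ideal_Delta.
- apply: (@lspan_sub _ _ _ [set x | eps Q x = 0]).
    split=> /= [|c u v hu hv]; first by rewrite linear0.
    have -> : eps Q (c *: u + v) = c * eps Q u + eps Q v by exact: linearP.
    by rewrite (hu : eps Q u = 0) (hv : eps Q v = 0) mulr0 addr0.
  move=> _ [h _ [j Jj <-]] /=.
  have -> : eps Q (h * j) = eps Q h * eps Q j by exact: rmorphM.
  by rewrite (qhi_eps hJ Jj) mulr0.
- apply: (@lspan_sub _ _ _ [set x | induced_ideal J (antipode Q x)]).
    split=> /= [|c u v hu hv].
      by rewrite linear0; exact: lspan0.
    by rewrite linearP; apply: (subspace_lspan _).2.
  move=> _ [h _ [j Jj <-]] /=; rewrite qh_antipodeM.
  by apply: ideal_mul_induced; apply: (qhi_antipode hJ).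
Qed.

Definition induced_qhIdeal : qhIdeal Q := QhIdeal induced_ideal_qh.

End InducedIdeal.

Section Equivariant.
Variable I : qhIdeal Q.

Definition qcomponent (g : G) : set (quot I) := qproj I @` gr g.

(* s lists the pairs (h_i, h_i') of a decomposition of 1. *)
Definition unit_decomposition (g : G) (s : seq (quot I * quot I)) : Prop :=
  (forall p, p \in s -> qcomponent g p.1 /\ qcomponent g^-1%g p.2)
  /\ \sum_(p <- s) p.1 * p.2 = 1.

(* The conjugate of x by g, computed from a chosen decomposition of 1; it does *)
(* not depend on the choice when x commutes with qcomponent 1.                 *)
Definition gconj (g : G) (x : quot I) : quot I :=
  \sum_(p <- xget [::] (unit_decomposition g)) p.1 * x * p.2.

(* A family indexed by N is a function on G of which only the values on N are  *)
(* used; the lifted quotient H_N / J^N is qproj I @` subgroup_part N.          *)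
Record grouplike_splitting (N : set G) (u : G -> quot I) : Prop :=
  GrouplikeSplitting {
  gls_degree : forall n, N n -> qcomponent n (u n);
  gls_unit : forall n, N n ->
    exists2 v, (qproj I @` subgroup_part N) v & u n * v = 1 /\ v * u n = 1;
  gls_grouplike : forall n, N n -> grouplike (quot_quasiHopf I) (u n);
  gls_mul : forall n m, N n -> N m -> u n * u m = u (n * m)%g;
  gls_comm : forall n b, N n -> qcomponent 1%g b -> u n * b = b * u n
}.

Definition equivariant_family (N : set G) (u : G -> quot I) : Prop :=
  grouplike_splitting N u /\
  forall g n, N n -> gconj g (u n) = u (g * n * g^-1)%g.

End Equivariant.

Definition admits_equivariant_family (N : set G) (J : set H)
    (hJ : qh_ideal Q (gr 1%g) J) (invJ : G_invariant J) : Prop :=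
  exists u : G -> quot (induced_qhIdeal hJ invJ), equivariant_family N u.

End Graded.

(* Main.v *)
Require Import Defs.
From HB Require Import structures.
From mathcomp Require Import all_boot all_order all_algebra finmap.
From mathcomp Require Import boolp classical_sets.
From mathcomp Require Import monalg.

(* Write q : H -> K = H/J^G and K_g = q(H_g).                                  *)
(* Given u, let I be the preimage under q of the ideal spanned by the          *)
(* (u_n - 1)K; it is two-sided by equivariance. The map sending x_n in H_n to  *)
(* u_n^-1 q(x_n) for n in N, and the other components to 0, kills I and is q   *)
(* on H_e, whence I meets H_e in J only; followed by eps, it gives N_I = N.    *)
(* Given I, let A_g be the image of H_g in L = H/I. If A_g meets A_e           *)
(* nontrivially, the antipode and zigzag identities, applied in the            *)
(* subcoalgebra which is the intersection of A_g and A_e, put 1 in A_g, so    *)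
(* A_g = A_e; and A_e is independent of the A_g which meet it trivially. If x  *)
(* in I has grading map zeta_n - zeta_e, the part of x in degrees g with       *)
(* A_g = A_e therefore vanishes in L, and eps forces n to be one of these      *)
(* degrees. Hence 1 lifts to some v_n in H_n with v_n - 1 in I. The image I'   *)
(* of I in K meets every K_n trivially, so u_n = q(v_n) is unique and inherits *)
(* every property required of it from 1.                                       *)

Set Implicit Arguments.
Unset Strict Implicit.
Unset Printing Implicit Defensive.

Import GRing.Theory.

Local Open Scope classical_set_scope.
Local Open Scope ring_scope.

(** Both directions rest on homogeneous elements congruent to 1 modulo the ideal.

    From I to a family: H/I is only pregraded, because the images of different components may
    overlap. By [component_one], an image either contains 1 or meets the neutral one trivially, and
    by [component1_independent] the neutral image also meets the sum of all images of the second
    kind trivially. Counting values of the counit, [one_mod_ideal] then finds, for n in N_I, some v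
    in H_n with v - 1 in I. Strongness ([pregrading_strong]) propagates the condition on I in degree
    e to every degree ([ideal_component]), so v is unique modulo J^G. Uniqueness forces the
    relations of an equivariant family ([family_of_ideal]), and a projection argument gives
    group-likeness ([lift_grouplike]).

    From a family to I: equivariance ([family_commute]) makes the right ideal generated by the u_n -
    1 two-sided, and [antipode_grouplike] makes it stable under S. That its preimage is not too
    large is seen from a linear map killing it which is the projection in degree e
    ([graded_untwist_ideal]); [family_ideal_subgroup] and [family_ideal_cap] are read off from this
    map. *)

Section Linear.
Variable k : fieldType.

(** * Linear algebra: complements, projections, subspaces of tensor products *)

Definition to_linear (V W : lmodType k) (f : V -> W) (lf : linear f) :
  {linear V -> W} := HB.pack f (GRing.isLinear.Build k V W *:%R f lf).

Lemma max_complement (V : lmodType k) (A B : set V) :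
  subspace B -> (forall x, A x -> B x -> x = 0) ->
  exists M : set V, [/\ subspace M, B `<=` M, forall x, A x -> M x -> x = 0
    & forall M', subspace M' -> M `<=` M' -> (forall x, A x -> M' x -> x = 0) ->
      M' `<=` M].
Proof.
move=> sB AB.
pose P (M : set V) := M = set0 \/
  [/\ subspace M, B `<=` M & forall x, A x -> M x -> x = 0].
have [M [PM maxM]] : exists M, P M /\ forall M', M `<` M' -> ~ P M'.
  apply: Zorn_bigcup => F FP Ftot.
  have [[C [FC [c Cc]]]|Fe] := pselect (exists C, F C /\ C !=set0); last first.
    left; rewrite -subset0 => x [C FC Cx]; apply: Fe.
    by exists C; split => //; exists x.
  have ss D d : F D -> D d ->
      [/\ subspace D, B `<=` D & forall x, A x -> D x -> x = 0].
    by move=> FD Dd; case: (FP D FD) => // D0; rewrite D0 in Dd.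
  right; split.
  - split; first by exists C => //; case: (ss C c FC Cc) => -[].
    move=> a x y [D FD Dx] [E FE Ey].
    case: (ss D x FD Dx) => -[_ hD] _ _; case: (ss E y FE Ey) => -[_ hE] _ _.
    by case: (Ftot D E FD FE) => h; [exists E | exists D] => //;
      [apply: hE => //; apply: h | apply: hD => //; apply: h].
  - by move=> b Bb; exists C => //; case: (ss C c FC Cc) => _ + _; apply.
  - by move=> x Ax [D FD Dx]; case: (ss D x FD Dx) => _ _; apply.
case: PM => [M0|[sM BM AM]].
  exfalso; apply: (maxM B); last by right; split.
  by rewrite M0; split => // h; have := h 0 sB.1.
exists M; split => // M' sM' MM' AM'; apply: contrapT => nM.
apply: (maxM M'); first by split.
by right; split => //; apply: subset_trans MM'.
Qed.

(** A maximal M containing B and meeting A trivially is a complement of A. Such projections, applied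
    to the legs of a tensor, are how membership in A ⊗ B is exploited below. *)
Lemma retraction (V : lmodType k) (A B : set V) :
  subspace A -> subspace B -> (forall x, A x -> B x -> x = 0) ->
  exists P : {linear V -> V}, [/\ forall x, A (P x), forall x, A x -> P x = x
    & forall x, B x -> P x = 0].
Proof.
move=> sA sB AB; have [M [sM BM AM maxM]] := max_complement sB AB.
have ex x : exists a, A a /\ M (x - a).
  pose M' := sumset M [set c *: x | c in @setT k].
  have sL : subspace [set c *: x | c in @setT k].
    split; first by exists 0 => //; rewrite scale0r.
    move=> a _ _ [c _ <-] [d _ <-]; exists (a * c + d) => //.
    by rewrite scalerDl scalerA.
  have MM' : M `<=` M'.
    by move=> m Mm; exists m => //; exists 0; [exists 0 => //; rewrite scale0r | rewrite addr0].
  (* If M plus the line of x still meets A trivially, then x is in M and a = 0 works. Otherwise A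
     has a nonzero y = m + c x with c nonzero, and a = y / c works. *)
  have [h|] := pselect (forall y, A y -> M' y -> y = 0).
    exists 0; split; first exact: sA.1.
    rewrite subr0; apply: (maxM M') => //; first exact: subspace_sumset.
    by exists 0; [exact: sM.1|exists x; [exists 1; rewrite ?scale1r|rewrite add0r]].
  move=> /existsNP [y /not_implyP [Ay /not_implyP [[m Mm [_ [c _ <-] my]] y0]]].
  have c0 : c != 0.
    by apply/eqP => c0; apply: y0; apply: AM => //; rewrite -my c0 scale0r addr0.
  exists (c^-1 *: y); split; first exact: subspaceZ.
  rewrite -my scalerDr scalerA mulVf // scale1r opprD addrCA subrr addr0.
  by apply: subspaceN => //; apply: subspaceZ.
pose f x := sval (cid (ex x)).
have fA x : A (f x) by rewrite /f; case: cid => ? [].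
have fM x : M (x - f x) by rewrite /f; case: cid => ? [].
have uf x a : A a -> M (x - a) -> f x = a.
  move=> Aa Ma; apply/eqP; rewrite -subr_eq0; apply/eqP; apply: AM.
    exact: subspaceB.
  have := subspaceB sM Ma (fM x); rewrite opprB [X in M X]addrC addrA.
  by rewrite subrK.
have lf : linear f.
  move=> a x y; apply: uf; first exact: sA.2.
  have := sM.2 a _ _ (fM x) (fM y).
  by rewrite scalerBr addrACA -opprD.
exists (to_linear lf); split => //= x hx; apply: uf => //.
- by rewrite subrr; exact: sM.1.
- exact: sA.1.
- by rewrite subr0; apply: BM.
Qed.

Lemma tlift_mem (U V W : lmodType k) (f : U -> V -> W) (A : set U) (B : set V)
    (C : set W) t :
  bilinear_fun f -> subspace C -> (forall a b, A a -> B b -> C (f a b)) ->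
  tensor_sub A B t -> C (tlift f t).
Proof.
move=> bf sC h; apply: (@lspan_sub _ _ _ [set s | C (tlift f s)]).
  split=> /= [|a x y hx hy]; first by rewrite (tlift_zero bf); exact: sC.1.
  by rewrite tlift_linear //; apply: sC.2.
by move=> _ [u Au [v Bv <-]] /=; rewrite tlift_tens //; apply: h.
Qed.

Lemma tmap_id (U V : lmodType k) (f : {linear U -> U}) (g : {linear V -> V})
    (A : set U) (B : set V) t :
  (forall a, A a -> f a = a) -> (forall b, B b -> g b = b) ->
  tensor_sub A B t -> tmap f g t = t.
Proof.
move=> hf hg; apply: (@lspan_sub _ _ _ [set s | tmap f g s = s]).
  split=> /= [|a x y hx hy]; first by rewrite linear0.
  by rewrite linearP; congr (_ *: _ + _).
by move=> _ [u Au [v Bv <-]] /=; rewrite tmapE hf // hg.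
Qed.

Lemma mulset_seq (K : algType k) (A B : set K) x : subspace A -> mulset A B x ->
  exists s : seq (K * K), (forall p, p \in s -> A p.1 /\ B p.2) /\
    x = \sum_(p <- s) p.1 * p.2.
Proof.
move=> sA [s [hs ->]]; elim: s hs => [|[c y] s IH] hs.
  by exists [::]; split => //; rewrite !big_nil.
have [|t [ht e]] := IH; first by move=> p ps; apply: hs; rewrite inE ps orbT.
have /= [a Aa [b Bb ab]] := hs (c, y) (mem_head _ _).
exists ((c *: a, b) :: t); split; last first.
  by rewrite !big_cons e /= -ab scalerAl.
move=> p; rewrite inE => /orP[/eqP->|/ht//]; split => //; exact: subspaceZ.
Qed.

Lemma tens_sub (U V : lmodType k) (a a' : U) (b b' : V) :
  a ⊗ b - a' ⊗ b' = (a - a') ⊗ b + a' ⊗ (b - b').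
Proof.
have tB := tens_bilinear U V.
have := bilinearDl tB (a - a') a' b; have := bilinearDr tB a' (b - b') b'.
by rewrite !subrK => -> ->; rewrite addrA addrK.
Qed.

Lemma subspace_set0 (V : lmodType k) : subspace [set 0 : V].
Proof. by split=> // a u v /= -> ->; rewrite scaler0 addr0. Qed.

(** The coideal condition of [qh_ideal] for the whole algebra. *)
Definition tensor_ideal (U : lmodType k) (E : set U) : set (U ⊗ U) :=
  sumset (tensor_sub E setT) (tensor_sub setT E).

Lemma subspace_tensor_ideal (U : lmodType k) (E : set U) :
  subspace (tensor_ideal E).
Proof. by apply: subspace_sumset; apply: subspace_lspan. Qed.

Lemma tensor_ideall (U : lmodType k) (E : set U) a b : E a -> tensor_ideal E (a ⊗ b).
Proof.
move=> ha; exists (a ⊗ b); first by apply: lspan_mem; exists a => //; exists b.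
by exists 0; [exact: lspan0 | rewrite addr0].
Qed.

Lemma tensor_idealr (U : lmodType k) (E : set U) a b : E b -> tensor_ideal E (a ⊗ b).
Proof.
move=> hb; exists 0; first exact: lspan0.
by exists (a ⊗ b); [apply: lspan_mem; exists a => //; exists b | rewrite add0r].
Qed.

End Linear.

(** * Pregradings: strongness and overlaps of components *)

Section Pregradings.
Variables (k : fieldType) (G : groupType).

(* The properties of a grading that pass to all quotients H/I; the sum of the *)
(* A g may fail to be direct there.                                           *)
Record pregrading (K : algType k) (P : quasiHopf K) (A : G -> set K) : Prop :=
    Pregrading {
  pg_subspace : forall g, subspace (A g);
  pg_span : forall x, exists (s : seq G) (c : G -> K),
    (forall g, A g (c g)) /\ x = \sum_(g <- s) c g;
  pg_eps : forall g, exists2 x, A g x & eps P x != 0;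
  pg_mul : forall g h x y, A g x -> A h y -> A (g * h)%g (x * y);
  pg_Delta : forall g x, A g x -> tensor_sub (A g) (A g) (Delta P x);
  pg_antipode : forall g x, A g x -> A g^-1%g (antipode P x);
  pg_Phi : tensor_sub (A 1%g) (tensor_sub (A 1%g) (A 1%g)) (Phi P);
  pg_alpha : A 1%g (alpha P);
  pg_beta : A 1%g (beta P)
}.

(** If eps vanished on B, the counit axiom applied to the second leg would give x = 0. *)
Lemma counit_mem (K : algType k) (P : quasiHopf K) (A B : set K) x :
  tensor_sub A B (Delta P x) -> x != 0 -> exists2 b, B b & eps P b != 0.
Proof.
move=> hx x0; apply: contrapT => nb; case/eqP: x0.
rewrite -(qh_counitr P x); apply: (tlift_mem (C := [set 0])) hx.
- exact: scale_epsr_bilinear.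
- exact: subspace_set0.
- move=> a b _ Bb /=; have [->|b0] := eqVneq (eps P b) 0; first by rewrite scale0r.
  by case: nb; exists b.
Qed.

Lemma faithful_pregrading (H : algType k) (Q : quasiHopf H) (gr : grading G Q) :
  faithfully_graded gr -> pregrading Q gr.
Proof.
move=> fgr; split; try by case: gr {fgr}.
  by move=> x; have [c [hc ->]] := gr_decomp gr x; exists (finsupp c), c.
move=> g; have [x gx x0] := fgr g.
exact: counit_mem (gr_Delta gx) x0.
Qed.

Lemma antipode_alpha_bilinear (K : algType k) (P : quasiHopf K) :
  bilinear_fun (fun a b => antipode P a * alpha P * b).
Proof.
by split=> [b|a] c u v; rewrite ?linearP ?mulrDr ?mulrDl -?scalerAl -?scalerAr.
Qed.

Lemma zigzag_trilinear (K : algType k) (P : quasiHopf K) :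
  trilinear_fun (fun a b c => a * beta P * antipode P b * alpha P * c).
Proof.
by split=> [v w|u]; [|split=> [v|w]] => c x y;
  rewrite ?linearP ?(mulrDr, mulrDl) -?(scalerAl, scalerAr) ?(mulrDr, mulrDl)
    -?(scalerAl, scalerAr).
Qed.

Section Pregrading.
Variables (K : algType k) (P : quasiHopf K) (A : G -> set K).
Hypothesis pA : pregrading P A.

Lemma pregrading_ind (R : K -> Prop) : R 0 ->
  (forall x y, R x -> R y -> R (x + y)) -> (forall g x, A g x -> R x) ->
  forall x, R x.
Proof.
move=> R0 RD RA x; have [s [c [hc ->]]] := pg_span pA x.
by elim/big_ind: _ => // g _; apply: RA (hc g).
Qed.

(* The zigzag identity exhibits 1 in the A_1-bimodule generated by alpha. *)
Lemma one_of_alpha (C : set K) : subspace C ->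
  (forall a x, A 1%g a -> C x -> C (a * x)) ->
  (forall a x, A 1%g a -> C x -> C (x * a)) ->
  C (alpha P) -> C 1.
Proof.
move=> sC Cl Cr Ca; rewrite -(qh_zigzag P).
have [_ tz] := zigzag_trilinear P.
apply: (tlift_mem (trilinear_tlift (zigzag_trilinear P)) sC) (pg_Phi pA).
move=> a t Aa; apply: (tlift_mem (tz a) sC) => b c Ab Ac.
apply: Cr => //; apply: Cl => //; rewrite -[1%g]mulg1; apply: (pg_mul pA); last first.
  by rewrite -invg1; apply: (pg_antipode pA).
by rewrite -[1%g]mulg1; apply: (pg_mul pA) => //; apply: pg_beta pA.
Qed.

Lemma pg_one : A 1%g 1.
Proof.
apply: one_of_alpha (pg_alpha pA); first exact: pg_subspace pA _.
  by move=> a x Aa Ax; rewrite -[1%g]mulg1; apply: (pg_mul pA).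
by move=> a x Aa Ax; rewrite -[1%g]mulg1; apply: (pg_mul pA).
Qed.

(** The antipode axiom at x, divided by eps(x). Combined with [one_of_alpha], it puts 1 into an
    A_1-bimodule. *)
Lemma alpha_mem (D E C : set K) x : subspace C -> tensor_sub D E (Delta P x) ->
  eps P x != 0 -> (forall a b, D a -> E b -> C (antipode P a * alpha P * b)) ->
  C (alpha P).
Proof.
move=> sC hx ex h; have : C (eps P x *: alpha P).
  by rewrite -qh_alphaP; apply: tlift_mem hx => //; exact: antipode_alpha_bilinear.
by move/(subspaceZ (eps P x)^-1 sC); rewrite scalerA mulVf ?scale1r.
Qed.

(** The product C of the two components is an A_1-bimodule. For x in degree g^-1 with eps(x)
    nonzero, S(x') alpha x'' lies in C, so alpha and hence 1 do. *)
Lemma pregrading_strong g : mulset (A g) (A g^-1%g) 1.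
Proof.
set C := mulset _ _; have sC : subspace C by exact: subspace_lspan.
apply: (one_of_alpha sC) => [a x Aa|a x Aa|].
- apply: (@lspan_sub _ _ _ [set x | C (a * x)]).
    split=> /= [|c u v hu hv]; first by rewrite mulr0; exact: lspan0.
    by rewrite mulrDr -scalerAr; apply: sC.2.
  move=> _ [b Ab [c Ac <-]] /=; rewrite mulrA; apply: lspan_mem.
  by exists (a * b); [rewrite -[g]mul1g; apply: (pg_mul pA)|exists c].
- apply: (@lspan_sub _ _ _ [set x | C (x * a)]).
    split=> /= [|c u v hu hv]; first by rewrite mul0r; exact: lspan0.
    by rewrite mulrDl -scalerAl; apply: sC.2.
  move=> _ [b Ab [c Ac <-]] /=; rewrite -mulrA; apply: lspan_mem.
  by exists b => //; exists (c * a) => //; rewrite -[_^-1%g]mulg1; apply: (pg_mul pA).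
- have [x Ax ex] := pg_eps pA g^-1%g.
  apply: (alpha_mem sC (pg_Delta pA Ax) ex) => a b Aa Ab; apply: lspan_mem.
  exists (antipode P a * alpha P); last by exists b.
  rewrite -[g]mulg1; apply: (pg_mul pA); last exact: pg_alpha pA.
  by rewrite -[g]invgK; apply: (pg_antipode pA).
Qed.

Lemma pregrading_unit g : exists s : seq (K * K),
  (forall p, p \in s -> A g p.1 /\ A g^-1%g p.2) /\ \sum_(p <- s) p.1 * p.2 = 1.
Proof.
have [s [hs ->]] := mulset_seq (pg_subspace pA g) (pregrading_strong g).
by exists s.
Qed.

(** The intersection C of A_1 and A_g is an A_1-bimodule with Delta(C) inside A_1 ⊗ C. As C is
    nonzero, it has an element c with eps(c) nonzero, and S(c') alpha c'' in C yields alpha and then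
    1 in C. *)
Lemma component_one g y : A 1%g y -> A g y -> y != 0 -> A g 1.
Proof.
move=> A1y Agy y0; pose C := A 1%g `&` A g.
have sC : subspace C.
  split; first by split; [exact: (pg_subspace pA _).1|exact: (pg_subspace pA _).1].
  by move=> a u v [? ?] [? ?]; split; apply: (pg_subspace pA _).2.
have Cl a x : A 1%g a -> C x -> C (a * x).
  move=> Aa [A1x Agx]; split; first by rewrite -[1%g]mulg1; apply: (pg_mul pA).
  by rewrite -[g]mul1g; apply: (pg_mul pA).
have Cr a x : A 1%g a -> C x -> C (x * a).
  move=> Aa [A1x Agx]; split; first by rewrite -[1%g]mulg1; apply: (pg_mul pA).
  by rewrite -[g]mulg1; apply: (pg_mul pA).
have [p [pC p1 _]] := retraction sC (subspace_set0 K) (fun x _ e => e).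
pose B := A 1%g `&` [set x | p x = 0].
have sB : subspace B.
  split; first by split; [exact: (pg_subspace pA _).1|rewrite /= linear0].
  move=> a u v [Au /= pu] [Av /= pv]; split; first exact: (pg_subspace pA _).2.
  by rewrite /= linearP pu pv scaler0 addr0.
have AB x : A g x -> B x -> x = 0.
  by move=> Ax [A1x /= <-]; rewrite p1.
have [q [qA q1 qB]] := retraction (pg_subspace pA g) sB AB.
(* q is a projection onto A g which maps A 1 into C. *)
have qC x : A 1%g x -> C (q x).
  move=> A1x; suff -> : q x = p x by [].
  rewrite -[in LHS](subrK (p x) x) linearD /= qB ?add0r; first exact: q1 (pC x).2.
  split; first by apply: subspaceB => //; [exact: pg_subspace pA _|exact: (pC x).1].
  by rewrite /= linearB /= (p1 _ (pC x)) subrr.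
(* Applying q to the second leg fixes Delta(x), which lies in A_g ⊗ A_g, and also sends it into A_1
   ⊗ C, since it lies in A_1 ⊗ A_1. *)
have DC x : C x -> tensor_sub (A 1%g) C (Delta P x).
  move=> [A1x Agx].
  rewrite -(tmap_id (f := idfun) (g := q) _ q1 (pg_Delta pA Agx)) //.
  apply: tensor_sub_map (pg_Delta pA A1x); first exact: subspace_lspan.
  by move=> u v Au Av; apply: lspan_mem; exists u => //; exists (q v) => //; apply: qC.
have [c Cc ec] := counit_mem (DC y (conj A1y Agy)) y0.
suff : C 1 by case.
apply: (one_of_alpha sC Cl Cr); apply: (alpha_mem sC (DC c Cc) ec) => a b Aa Cb.
apply: Cl => //; rewrite -[1%g]mulg1; apply: (pg_mul pA); last exact: pg_alpha pA.
by rewrite -invg1; apply: (pg_antipode pA).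
Qed.

(* The A g with ~ A g 1 meet A 1 trivially. They are removed one at a time by *)
(* applying to the first leg of the comultiplication a functional which is    *)
(* eps on A 1 and 0 on the component to be removed.                           *)
Lemma component1_independent (s : seq G) (z : G -> K) y : (forall g, A g (z g)) ->
  (forall g, g \in s -> ~ A g 1) ->
  A 1%g y -> y = \sum_(g <- s) z g -> y = 0.
Proof.
move=> Az; elim: s z Az y => [|g s IH] z Az y hs Ay; first by rewrite big_nil.
rewrite big_cons => e.
have [|p [pA1 p1 pg]] := retraction (pg_subspace pA 1%g) (pg_subspace pA g).
  move=> x A1x Agx; apply/eqP/negPn/negP => /(component_one A1x Agx).
  by apply: hs; rewrite inE eqxx.
pose f (t : K) : K := tlift (fun a b => eps P (p a) *: b) (Delta P t).
have bf : bilinear_fun (fun a b : K => eps P (p a) *: b).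
  split=> [b|a] c u v; last by rewrite scalerDr !scalerA mulrC.
  have -> : eps P (p (c *: u + v)) = c * eps P (p u) + eps P (p v).
    by rewrite !linearP.
  by rewrite scalerDl scalerA.
have lf : linear f by move=> a u v; rewrite /f linearP (tlift_linear bf).
have fA h x : A h x -> A h (f x).
  move=> Ax; apply: tlift_mem (pg_Delta pA Ax) => //; first exact: pg_subspace pA _.
  by move=> a b _ Ab; apply: subspaceZ => //; exact: pg_subspace pA _.
have f1 x : A 1%g x -> f x = x.
  move=> Ax; rewrite -[RHS](qh_counitl P x).
  rewrite -[in RHS](tmap_id (f := p) (g := idfun) p1 _ (pg_Delta pA Ax)) //.
  by rewrite tlift_tmap //; exact: scale_epsl_bilinear.
have fg x : A g x -> f x = 0.
  move=> Ax; apply: (tlift_mem (C := [set 0]) bf) (pg_Delta pA Ax).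
    exact: subspace_set0.
  by move=> a b Aa _ /=; rewrite (pg _ Aa) linear0 scale0r.
apply: (IH (f \o z)) => //=.
- by move=> h; apply: fA.
- by move=> h hs'; apply: hs; rewrite inE hs' orbT.
rewrite -[LHS]f1 // e -[f _]/(to_linear lf _) linearD linear_sum /=.
by rewrite fg // add0r.
Qed.

End Pregrading.

Lemma quot_pregrading (H : algType k) (Q : quasiHopf H) (gr : grading G Q)
    (I : qhIdeal Q) : faithfully_graded gr ->
  pregrading (quot_quasiHopf I) (@qcomponent _ _ _ _ gr I).
Proof.
move=> /faithful_pregrading pg; split.
- move=> g; split; first by exists 0; [exact: (gr_subspace gr g).1|rewrite linear0].
  move=> a _ _ [x gx <-] [y gy <-]; exists (a *: x + y); last by rewrite linearP.
  exact: (gr_subspace gr g).2.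
- elim/quot_ind=> x; have [s [c [hc ->]]] := pg_span pg x.
  exists s, (qproj I \o c); split; last by rewrite linear_sum.
  by move=> g; exists (c g).
- move=> g; have [x gx ex] := pg_eps pg g.
  by exists (qproj I x); [exists x|rewrite /= quot_epsE].
- move=> g h _ _ [x gx <-] [y gy <-]; exists (x * y); last by rewrite rmorphM.
  exact: (gr_mul gx gy).
- move=> g _ [x gx <-] /=; rewrite quot_DeltaE.
  apply: tensor_sub_map (gr_Delta gx); first exact: subspace_lspan.
  by move=> u v gu gv; apply: lspan_mem; exists (qproj I u); [exists u|exists (qproj I v) => //; exists v].
- move=> g _ [x gx <-] /=; rewrite quot_antipodeE; exists (antipode Q x) => //.
  exact: gr_antipode.
- apply: tensor_sub_map (gr_Phi gr); first exact: subspace_lspan.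
  move=> u t gu gt; apply: lspan_mem; exists (qproj I u); first by exists u.
  exists (tmap (qproj I) (qproj I) t) => //.
  apply: tensor_sub_map gt; first exact: subspace_lspan.
  by move=> a b ga gb; apply: lspan_mem; exists (qproj I a); [exists a|exists (qproj I b) => //; exists b].
- by exists (alpha Q) => //; apply: gr_alpha.
- by exists (beta Q) => //; apply: gr_beta.
Qed.

End Pregradings.

(** * Homogeneous parts in H and the grading map *)

Section HomogeneousDecomposition.
Variables (k : fieldType) (G : groupType) (H : algType k) (Q : quasiHopf H).
Variable gr : grading G Q.

Lemma decomp_mem x g : gr g (decomp gr x g).
Proof. exact: (svalP (cid (gr_decomp gr x))).1. Qed.

Lemma decomp_sum x : x = \sum_(g <- finsupp (decomp gr x)) decomp gr x g.
Proof. exact: (svalP (cid (gr_decomp gr x))).2. Qed.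

Lemma sum_finsupp (V W : lmodType k) (c : {fsfun G -> V with 0})
    (f : G -> {linear V -> W}) (S : {fset G}) : (finsupp c `<=` S)%fset ->
  \sum_(g <- finsupp c) f g (c g) = \sum_(g <- S) f g (c g).
Proof.
move=> cS; apply: big_fset_incl cS _ => g _ gc.
by rewrite fsfun_dflt // linear0.
Qed.

Lemma decomp_unique x (c : {fsfun G -> H with 0}) :
  (forall g, gr g (c g)) -> x = \sum_(g <- finsupp c) c g -> decomp gr x = c.
Proof.
move=> hc e; apply/fsfunP => g; apply/eqP; rewrite -subr_eq0; apply/eqP.
pose S := (finsupp (decomp gr x) `|` finsupp c)%fset.
pose d := [fsfun h in S => decomp gr x h - c h] : {fsfun G -> H with 0}.
have dE h : d h = decomp gr x h - c h.
  rewrite fsfunE; case: ifP => // /negbT; rewrite inE negb_or => /andP[h1 h2].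
  by rewrite (fsfun_dflt h1) (fsfun_dflt h2) subrr.
have dS : (finsupp d `<=` S)%fset by exact: finsupp_sub.
rewrite -dE; apply: (@gr_direct _ _ _ _ gr d).
  by move=> h; rewrite dE; apply: subspaceB => //; [exact: gr_subspace|exact: decomp_mem].
rewrite (sum_finsupp (fun=> idfun) dS) /=.
under eq_bigr do rewrite dE.
rewrite big_split /= sumrN.
rewrite -(sum_finsupp (fun=> idfun) (fsubsetUl _ _ : finsupp (decomp gr x) `<=` S)%fset) /=.
rewrite -(sum_finsupp (fun=> idfun) (fsubsetUr _ _ : finsupp c `<=` S)%fset) /=.
by rewrite -decomp_sum -e subrr.
Qed.

Lemma decomp_linear g : linear (fun x => decomp gr x g).
Proof.
move=> a x y.
pose S := (finsupp (decomp gr x) `|` finsupp (decomp gr y))%fset.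
pose d := [fsfun h in S => a *: decomp gr x h + decomp gr y h] : {fsfun G -> H with 0}.
have dE h : d h = a *: decomp gr x h + decomp gr y h.
  rewrite fsfunE; case: ifP => // /negbT; rewrite inE negb_or => /andP[h1 h2].
  by rewrite (fsfun_dflt h1) (fsfun_dflt h2) scaler0 addr0.
rewrite -dE; congr (fun_of_fsfun _ g); apply: decomp_unique.
  by move=> h; rewrite dE; apply: (gr_subspace gr h).2; exact: decomp_mem.
rewrite [RHS](sum_finsupp (fun=> idfun) (finsupp_sub _ _ _ : finsupp d `<=` S)%fset) /=.
under eq_bigr do rewrite dE.
rewrite big_split /= -scaler_sumr.
rewrite -(sum_finsupp (fun=> idfun) (fsubsetUl _ _ : finsupp (decomp gr x) `<=` S)%fset) /=.
rewrite -(sum_finsupp (fun=> idfun) (fsubsetUr _ _ : finsupp (decomp gr y) `<=` S)%fset) /=.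
by rewrite -!decomp_sum.
Qed.

Lemma decomp_hom g x h : gr g x -> decomp gr x h = if h == g then x else 0.
Proof.
move=> gx; pose d := [fsfun h in [fset g]%fset => x] : {fsfun G -> H with 0}.
have dE h' : d h' = if h' == g then x else 0 by rewrite fsfunE inE.
rewrite -dE; congr (fun_of_fsfun _ h); apply: decomp_unique.
  by move=> h'; rewrite dE; case: eqP => [->//|_]; exact: (gr_subspace gr _).1.
rewrite [RHS](sum_finsupp (fun=> idfun) (finsupp_sub _ _ _ : finsupp d `<=` [fset g])%fset) /=.
by rewrite big_seq_fset1 dE eqxx.
Qed.

Section GradedMap.
Variables (W : lmodType k) (f : G -> {linear H -> W}).

Definition graded_map (x : H) : W :=
  \sum_(g <- finsupp (decomp gr x)) f g (decomp gr x g).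

Lemma graded_map_linear : linear graded_map.
Proof.
move=> a x y; rewrite /graded_map.
pose S := (finsupp (decomp gr x) `|` (finsupp (decomp gr y) `|`
  finsupp (decomp gr (a *: x + y))))%fset.
rewrite (@sum_finsupp _ _ (decomp gr x) f S) ?fsubsetUl //.
rewrite (@sum_finsupp _ _ (decomp gr y) f S); last first.
  by rewrite /S fsetUCA fsubsetUl.
rewrite (@sum_finsupp _ _ (decomp gr (a *: x + y)) f S); last first.
  by rewrite /S fsetUA fsubsetUr.
rewrite scaler_sumr -big_split /=; apply: eq_bigr => g _.
by rewrite decomp_linear linearP.
Qed.

HB.instance Definition _ := GRing.isLinear.Build k H W *:%R graded_map graded_map_linear.

Lemma graded_map_hom g x : gr g x -> graded_map x = f g x.
Proof.
move=> gx; rewrite /graded_map (@sum_finsupp _ _ (decomp gr x) f [fset g]%fset).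
  by rewrite big_seq_fset1 (decomp_hom _ gx) eqxx.
apply/fsubsetP => h; rewrite mem_finsupp (decomp_hom _ gx) inE.
by case: (h == g) => //; rewrite eqxx.
Qed.

End GradedMap.

Lemma grading_map_coef x h : mcoeff h (grading_map gr x) = eps Q (decomp gr x h).
Proof.
rewrite /grading_map raddf_sum /=.
transitivity (\sum_(g <- finsupp (decomp gr x)) (g == h)%:R * eps Q (decomp gr x g)).
  by apply: eq_bigr => g _; rewrite mcoeffZ mcoeffU mulrC.
have [hs|hs] := boolP (h \in finsupp (decomp gr x)).
  rewrite (bigD1_seq h) //= ?eqxx ?mul1r ?big1 ?addr0 ?fset_uniq //.
  by move=> g /negbTE ->; rewrite mul0r.
rewrite (fsfun_dflt hs) linear0 big_seq big1 // => g gs.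
by case: eqP => [e|_]; [rewrite e (negbTE hs) in gs|rewrite mul0r].
Qed.

(** The only information drawn from the grading map. R will be the set of degrees whose image in H/I
    contains 1, and later N itself. *)
Lemma eps_sum x (n : G) (R : pred G) : n != 1%g ->
  grading_map gr x = zeta k n - zeta k 1%g ->
  \sum_(g <- finsupp (decomp gr x) | R g) eps Q (decomp gr x g)
  = (R n)%:R - (R 1%g)%:R.
Proof.
move=> n1 e; have ex h : eps Q (decomp gr x h) = (n == h)%:R - (1%g == h)%:R.
  by rewrite -grading_map_coef e mcoeffB !mcoeffU.
have supp g : (n == g)%:R - (1%g == g)%:R != 0 :> k -> g \in finsupp (decomp gr x).
  by rewrite -ex mem_finsupp; apply: contra => /eqP ->; rewrite linear0.
have sg g : g \in finsupp (decomp gr x) ->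
  \sum_(h <- finsupp (decomp gr x) | R h) (g == h)%:R = (R g)%:R :> k.
  move=> gs; rewrite big_mkcond /= (bigD1_seq g) ?fset_uniq //= eqxx big1 ?addr0.
    by case: (R g).
  by move=> h; rewrite eq_sym => /negbTE ->; case: (R h).
have n1' : (1%g == n) = false by rewrite eq_sym; exact: negbTE.
under eq_bigr do rewrite ex.
rewrite big_split /= sumrN !sg //.
  by apply: supp; rewrite (negbTE n1) eqxx sub0r oppr_eq0 oner_eq0.
by apply: supp; rewrite eqxx n1' subr0 oner_eq0.
Qed.

Hypothesis faithful_gr : faithfully_graded gr.
Let pg := faithful_pregrading faithful_gr.

Lemma decomp1_mulr a b : gr 1%g b -> decomp gr (a * b) 1%g = decomp gr a 1%g * b.
Proof.
have [d0 dD] : decomp gr 0 1%g = 0 /\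
    {morph (fun x => decomp gr x 1%g) : x y / x + y}.
  by split; [exact: (linear0 (to_linear (decomp_linear 1%g)))
            |exact: (linearD (to_linear (decomp_linear 1%g)))].
move=> gb; elim/(pregrading_ind pg): a => [|x y hx hy|g x gx].
- by rewrite mul0r d0 mul0r.
- by rewrite mulrDl !dD hx hy mulrDl.
have gxb : gr g (x * b) by rewrite -[g]mulg1; apply: gr_mul.
by rewrite (decomp_hom _ gx) (decomp_hom _ gxb); case: eqP => //; rewrite mul0r.
Qed.

(** The degree-e projection p is right H_e-linear and Phi has first leg in H_e, so p on the first
    leg of PhiV gives another left inverse of Phi, that is, PhiV again. *)
Lemma PhiV_mem : tensor_sub (gr 1%g) setT (PhiV Q).
Proof.
have [p pE] : exists p : {linear H -> H}, forall x, p x = decomp gr x 1%g.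
  by exists (to_linear (decomp_linear 1%g)).
have pM X Y : tensor_sub (gr 1%g) setT Y ->
    tmap p idfun (X * Y) = tmap p idfun X * Y :> (H ⊗ (H ⊗ H))%type.
  apply: (@lspan_sub _ _ _ [set Y | tmap p idfun (X * Y) = tmap p idfun X * Y]).
    split=> [|c u v hu hv]; rewrite /mkset; first by rewrite !mulr0 linear0.
    by rewrite !mulrDr -!scalerAr linearP; congr (_ *: _ + _).
  move=> _ [b gb [t _ <-]] /=.
  elim/tensor_ind: X => [|x y hx hy|a s]; first by rewrite mul0r linear0 mul0r.
    by rewrite mulrDl !linearD /= mulrDl hx hy.
  by rewrite tensM !tmapE tensM !pE decomp1_mulr.
have hPhi : tensor_sub (gr 1%g) setT (Phi Q).
  apply: lspan_sub (gr_Phi gr); first exact: subspace_lspan.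
  by move=> _ [a ga [t _ <-]]; apply: lspan_mem; exists a => //; exists t.
have p1 : p 1 = 1 by rewrite pE (decomp_hom _ (pg_one pg)) eqxx.
have -> : PhiV Q = tmap p idfun (PhiV Q).
  rewrite -[RHS]mulr1 -(qh_PhiK Q) mulrA -pM // qh_PhiVK tens1 tmapE p1 /=.
  by rewrite -tens1 mul1r.
elim/tensor_ind: (PhiV Q) => [|x y hx hy|a s].
- by rewrite linear0; exact: lspan0.
- by rewrite linearD; apply: subspaceD => //; exact: subspace_lspan.
- rewrite tmapE; apply: lspan_mem; exists (p a); first by rewrite pE; exact: decomp_mem.
  by exists s.
Qed.

(** The degree-e projection sends a product a j with j in J to a_e j, hence maps J^G into J. *)
Lemma induced_ideal_cap (J : set H) (hJ : qh_ideal Q (gr 1%g) J) x :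
  induced_ideal J x -> gr 1%g x -> J x.
Proof.
have [p pE] : exists p : {linear H -> H}, forall x, p x = decomp gr x 1%g.
  by exists (to_linear (decomp_linear 1%g)).
have sJ := qhi_subspace hJ.
suff h y : induced_ideal J y -> J (p y).
  by move=> Ix gx; have := h x Ix; rewrite pE (decomp_hom _ gx) eqxx.
move: y; apply: (@lspan_sub _ _ _ [set y | J (p y)]).
  split=> [|c u v hu hv]; rewrite /mkset ?linear0 ?linearP; first exact: sJ.1.
  exact: sJ.2.
move=> _ [a _ [j Jj <-]]; rewrite /mkset.
elim/(pregrading_ind pg): a => [|y z hy hz|g a ga].
- by rewrite mul0r linear0; exact: sJ.1.
- by rewrite mulrDl linearD; apply: subspaceD.
have gj := qhi_sub hJ Jj.
have gaj : gr g (a * j) by rewrite -[g]mulg1; apply: gr_mul.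
rewrite pE (decomp_hom _ gaj); case: eqP => [e|_]; last exact: sJ.1.
by apply: (qhi_mull hJ) => //; rewrite e.
Qed.

End HomogeneousDecomposition.

(** * Lifting 1 to the degrees in N_I *)

Section QuotientComponents.
Variables (k : fieldType) (G : groupType) (H : algType k) (Q : quasiHopf H).
Variable gr : grading G Q.

Lemma component_sub1 (K : algType k) (P : quasiHopf K) (A : G -> set K) g x :
  pregrading P A -> A g 1 -> A g x -> A 1%g x.
Proof.
move=> pA A1 Ax; rewrite -[x]mulr1 -[1%g](mulgV g); apply: (pg_mul pA) => //.
by rewrite -(qh_antipode1 P); apply: (pg_antipode pA).
Qed.

Hypothesis faithful_gr : faithfully_graded gr.

(** Modulo I, split x = 0 into the degrees whose image contains 1 and the others. The first part y
    lies in degree e and is minus the second, so y = 0 by independence. Its counit is 0 - 1 unless n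
    belongs to the first kind. *)
Lemma one_mod_ideal (I : qhIdeal Q) n : ideal_subgroup gr I n ->
  exists2 v, gr n v & (I : set H) (v - 1).
Proof.
have pB := quot_pregrading I faithful_gr.
set B := @qcomponent _ _ _ _ gr I in pB.
have [->|n1] := eqVneq n 1%g.
  move=> _; exists 1; first exact: pg_one (faithful_pregrading faithful_gr).
  by rewrite subrr; exact: (qhi_subspace (qhidealP I)).1.
move=> [x Ix /(eps_sum (fun g => `[< B g 1 >]) n1) ex].
suff [v gv ev] : B n 1 by exists v => //; apply/qproj_eq; rewrite ev rmorph1.
have e0 : \sum_(g <- finsupp (decomp gr x)) qproj I (decomp gr x g) = 0.
  by rewrite -linear_sum -decomp_sum; apply: qproj0.
rewrite (bigID (fun g => `[< B g 1 >])) /= in e0.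
set y := (X in X + _ = 0) in e0.
have By : B 1%g y.
  rewrite /y big_seq_cond; apply: big_ind => [|u v Bu Bv|g /andP[_ /asboolP Bg]].
  - exact: (pg_subspace pB _).1.
  - by apply: subspaceD => //; exact: pg_subspace pB _.
  - apply: component_sub1 pB Bg _.
    by exists (decomp gr x g) => //; exact: decomp_mem.
have y0 : y = 0.
  apply: (component1_independent pB (s := [seq g <- finsupp (decomp gr x) | ~~ `[< B g 1 >]])
    (z := fun g => - qproj I (decomp gr x g))) => //.
  - move=> g; apply: subspaceN; first exact: pg_subspace pB _.
    by exists (decomp gr x g) => //; exact: decomp_mem.
  - by move=> g; rewrite mem_filter => /andP[/asboolP].
  - by rewrite big_filter sumrN; apply/eqP; rewrite -addr_eq0 e0.
have : eps (quot_quasiHopf I) y = 0 by rewrite y0 linear0.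
rewrite /y linear_sum /=; under eq_bigr do rewrite quot_epsE.
rewrite ex; have -> : `[< B 1%g 1 >] = true by apply/asboolP; exact: pg_one pB.
by case: asboolP => // _ /eqP; rewrite sub0r oppr_eq0 oner_eq0.
Qed.

Variables (J : set H) (hJ : qh_ideal Q (gr 1%g) J) (invJ : G_invariant gr J).
Local Notation IJ := (induced_qhIdeal hJ invJ).
Local Notation K := (quot IJ).
Local Notation q := (qproj IJ).
Local Notation A := (@qcomponent _ _ _ _ gr IJ).

Let pA : pregrading (quot_quasiHopf IJ) A := quot_pregrading IJ faithful_gr.

Lemma qproj_surj (y : K) : exists x, q x = y.
Proof. by exists (repr y); exact: qprojK. Qed.

(** * From an ideal to an equivariant family *)

Section FromIdeal.
Variables (I : set H) (hI : qh_ideal Q setT I) (capI : I `&` gr 1%g = J).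

Let sI := qhi_subspace hI.

Lemma induced_sub x : induced_ideal J x -> I x.
Proof.
apply: lspan_sub => // _ [h _ [j Jj <-]]; apply: (qhi_mull hI) => //.
by move: Jj; rewrite -capI => -[].
Qed.

(** Write 1 as a sum of h_i h_i' with degrees n and n^-1. Then x is the sum of the h_i (h_i' x), and
    each h_i' x lies in I and in H_e, hence in J. *)
Lemma ideal_component x n : I x -> gr n x -> induced_ideal J x.
Proof.
move=> Ix gx; have [s [hs s1]] := pregrading_unit (faithful_pregrading faithful_gr) n.
rewrite -[x]mul1r -s1 mulr_suml; apply: subspace_sum; first exact: subspace_lspan.
move=> p /hs[p1 p2]; rewrite -mulrA; apply: lspan_mem; exists p.1 => //.
exists (p.2 * x) => //; rewrite -capI; split; first exact: (qhi_mull hI).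
by rewrite -(mulVg n); apply: gr_mul.
Qed.

Let I' := q @` I.

Let sI' : subspace I'.
Proof.
split; first by exists 0; [exact: sI.1|rewrite linear0].
move=> a _ _ [x Ix <-] [y Iy <-]; exists (a *: x + y); last by rewrite linearP.
exact: sI.2.
Qed.

Let I'E x : I' (q x) -> I x.
Proof.
move=> [y Iy /qproj_eq /induced_sub Iyx].
by rewrite -[x](subrK y); apply: subspaceD => //; rewrite -opprB; apply: subspaceN.
Qed.

Let I'l a x : I' x -> I' (a * x).
Proof.
have [b <-] := qproj_surj a => -[y Iy <-]; exists (b * y); last by rewrite rmorphM.
exact: (qhi_mull hI).
Qed.

Let I'r a x : I' x -> I' (x * a).
Proof.
have [b <-] := qproj_surj a => -[y Iy <-]; exists (y * b); last by rewrite rmorphM.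
exact: (qhi_mulr hI).
Qed.

(** Source of all uniqueness: a homogeneous element of K is determined by its degree and its class
    modulo the image I' of I. *)
Let I'0 n x : A n x -> I' x -> x = 0.
Proof.
move=> [y gy <-] /I'E Iy; apply: (qproj0 (I := IJ)); exact: ideal_component gy.
Qed.

Let I'_inj n x y : A n x -> A n y -> I' (x - y) -> x = y.
Proof.
move=> Ax Ay /I'0 h; apply/eqP; rewrite -subr_eq0; apply/eqP/(h n).
by apply: subspaceB => //; exact: pg_subspace pA _.
Qed.

Let I'_inj1 n x y : A n x -> A n y -> I' (x - 1) -> I' (y - 1) -> x = y.
Proof.
move=> Ax Ay Ix Iy; apply: I'_inj Ax Ay _.
by rewrite -[x](subrK 1) -addrA -[1 - y]opprB; apply: subspaceB.
Qed.

Let I'M x y : I' (x - 1) -> I' (y - 1) -> I' (x * y - 1).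
Proof.
move=> Ix Iy; have -> : x * y - 1 = (x - 1) * y + (y - 1).
  by rewrite mulrBl mul1r addrA subrK.
by apply: subspaceD => //; apply: I'r.
Qed.

(** The defect t = Delta(u) - u ⊗ u lies in A_n ⊗ A_n, so it is fixed by P ⊗ P for a projection P
    onto A_n killing I'. Since u is 1 modulo I', t also lies in I' ⊗ K + K ⊗ I', which P ⊗ P
    kills. *)
Lemma lift_grouplike n (u : K) : A n u -> I' (u - 1) ->
  grouplike (quot_quasiHopf IJ) u.
Proof.
move=> Au Iu; split; last first.
  apply/eqP; rewrite -subr_eq0 -(rmorph1 (eps (quot_quasiHopf IJ))) -rmorphB; apply/eqP.
  by move: Iu => [x Ix <-]; rewrite /= quot_epsE; exact: qhi_eps hI _ Ix.
have [P [_ PA PI]] := retraction (pg_subspace pA n) sI' (@I'0 n).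
pose t := Delta (quot_quasiHopf IJ) u - u ⊗ u.
suff : t = 0 by move/eqP; rewrite subr_eq0 => /eqP.
have tA : tensor_sub (A n) (A n) t.
  apply: subspaceB; [exact: subspace_lspan|exact: (pg_Delta pA)|].
  by apply: lspan_mem; exists u => //; exists u.
rewrite -(tmap_id PA PA tA).
pose Z := [set s : (K ⊗ K)%type | tmap P P s = 0].
have sZ : subspace Z.
  split=> [|a x y hx hy]; first by rewrite /Z /mkset linear0.
  transitivity (a *: tmap P P x + tmap P P y); first exact: linearP.
  by rewrite (hx : tmap P P x = 0) (hy : tmap P P y = 0) scaler0 addr0.
have Zl a b : I' a -> Z (a ⊗ b).
  by move=> Ia; rewrite /Z /mkset tmapE (PI a Ia) (bilinear0l (tens_bilinear _ _)).
have Zr a b : I' b -> Z (a ⊗ b).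
  by move=> Ib; rewrite /Z /mkset tmapE (PI b Ib) (bilinear0r (tens_bilinear _ _)).
have -> : t = Delta (quot_quasiHopf IJ) (u - 1) - ((u - 1) ⊗ u + 1 ⊗ (u - 1)).
  by rewrite -tens_sub rmorphB rmorph1 tens1 opprB addrA subrK.
apply: (subspaceB sZ); last by apply: subspaceD => //; [apply: Zl|apply: Zr].
move: Iu => [x Ix <-]; rewrite /= quot_DeltaE.
have [y Dy [z Dz <-]] := qhi_Delta hI Ix.
rewrite linearD; apply: subspaceD => //.
  apply: tensor_sub_map Dy => // a b Ia _; apply: Zl; exact: (imageP q Ia).
apply: tensor_sub_map Dz => // a b _ Ib; apply: Zr; exact: (imageP q Ib).
Qed.

Lemma family_of_ideal (N : set G) : normal_subgroup N -> ideal_subgroup gr I = N ->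
  admits_equivariant_family N hJ invJ.
Proof.
move=> [N1 NM NV NJ] IN.
have : forall n, exists v, N n -> gr n v /\ I (v - 1).
  move=> n; have [Nn|nN] := pselect (N n); last by exists 0.
  have [|v gv Iv] := @one_mod_ideal (QhIdeal hI) n; first by rewrite /= IN.
  by exists v.
move=> /choice[v hv]; pose u n := q (v n); exists u.
have uA n : N n -> A n (u n) by move=> /hv[gv _]; exists (v n).
have uI n : N n -> I' (u n - 1).
  by move=> /hv[_ Iv]; exists (v n - 1) => //; rewrite rmorphB rmorph1.
have uM n m : N n -> N m -> u n * u m = u (n * m)%g.
  move=> Nn Nm; apply: (@I'_inj1 (n * m)%g).
  - by apply: (pg_mul pA); apply: uA.
  - by apply/uA/NM.
  - by apply: I'M; apply: uI.
  - by apply/uI/NM.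
have u1 : u 1%g = 1.
  apply: (@I'_inj1 1%g) => //; [exact: uA|exact: pg_one pA|exact: uI|].
  by rewrite subrr; exact: sI'.1.
split; first split=> //.
- move=> n Nn; exists (u n^-1%g).
    exists (v n^-1%g) => //; apply: lspan_mem; exists n^-1%g; first exact: NV.
    by case: (hv _ (NV _ Nn)).
  by split; rewrite uM ?mulgV ?mulVg // ; exact: NV.
- by move=> n Nn; apply: lift_grouplike; [exact: uA|exact: uI].
- move=> n b Nn Ab; apply: (@I'_inj n).
  + by have := pg_mul pA (uA n Nn) Ab; rewrite mulg1.
  + by have := pg_mul pA Ab (uA n Nn); rewrite mul1g.
  (* Both sides of the commutation have degree n and differ by an element of I'. *)
  have -> : u n * b - b * u n = (u n - 1) * b - b * (u n - 1).
    by rewrite mulrBl mulrBr mul1r mulr1 opprB addrA subrK.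
  by apply: subspaceB => //; [apply: I'r; exact: uI|apply: I'l; exact: uI].
(* A decomposition of 1 exists by strongness, so [xget] does not fall back on its default.
   Conjugation then carries u_n - 1 in I' to the conjugate minus 1 in I'. *)
move=> g n Nn; rewrite /gconj; case: xgetP => [s _ [hs s1]|ns]; last first.
  have [s hs] := pregrading_unit pA g; by case: (ns s).
apply: (@I'_inj1 (g * n * g^-1)%g).
- apply: subspace_sum; first exact: pg_subspace pA _.
  by move=> p /hs[p1 p2]; apply: (pg_mul pA) => //; apply: (pg_mul pA) => //; exact: uA.
- by apply/uA/NJ.
- rewrite -s1 -sumrB; apply: subspace_sum => // p _.
  have -> : p.1 * u n * p.2 - p.1 * p.2 = p.1 * (u n - 1) * p.2.
    by rewrite mulrBr mulr1 mulrBl.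
  by apply: I'r; apply: I'l; exact: uI.
- by apply/uI/NJ.
Qed.

End FromIdeal.

(** * Coideals under preimage, and the antipode of a central-type group-like *)

(** [repr] is not linear, but subtracting its projection to I leaves a representative depending
    linearly on the class. *)
Lemma qproj_section (I : qhIdeal Q) :
  exists s : {linear quot I -> H}, forall y, qproj I (s y) = y.
Proof.
have sI := qhi_subspace (qhidealP I).
have [P [PI P1 _]] := retraction sI (subspace_set0 H) (fun x _ e => e).
pose s (y : quot I) := repr y - P (repr y).
have sE x : s (qproj I x) = x - P x.
  have := P1 _ (repr_qproj I x); rewrite linearB /= => e.
  by apply/eqP; rewrite /s subr_eq -addrA [- _ + _]addrC e addrC subrK.
have ls : linear s.
  move=> a; elim/quot_ind=> x; elim/quot_ind=> y; rewrite -linearP !sE.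
  by rewrite linearP scalerBr opprD addrACA.
exists (to_linear ls); elim/quot_ind=> x /=; rewrite sE; apply/qproj_eq.
by rewrite addrAC subrr add0r; apply: subspaceN.
Qed.

(** With a linear section s, the difference of t and its image under (s q) ⊗ (s q) has legs in the
    kernel of q, which lies in the preimage of E. *)
Lemma tensor_ideal_preim (I : qhIdeal Q) (E : set (quot I)) t : E 0 ->
  tensor_ideal E (tmap (qproj I) (qproj I) t) -> tensor_ideal (qproj I @^-1` E) t.
Proof.
move=> E0 ht; have sT := subspace_tensor_ideal (qproj I @^-1` E).
have [s sK] := qproj_section I.
have Es x : (qproj I @^-1` E) (x - s (qproj I x)).
  by rewrite /preimage /mkset linearB /= sK subrr.
rewrite -[t](subrK (tmap s s (tmap (qproj I) (qproj I) t))); apply: subspaceD => //.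
  elim/tensor_ind: t {ht} => [|x y hx hy|a b].
  - by rewrite !linear0 addr0; exact: sT.1.
  - by rewrite !linearD /= addrACA; apply: subspaceD.
  rewrite tmapE /= tmapE tens_sub.
  by apply: subspaceD => //; [apply: tensor_ideall|apply: tensor_idealr].
case: ht => x hx [y hy <-]; rewrite linearD; apply: subspaceD => //.
  by apply: tensor_sub_map hx => // a b Ea _; apply: tensor_ideall; rewrite /preimage /mkset sK.
by apply: tensor_sub_map hy => // a b _ Eb; apply: tensor_idealr; rewrite /preimage /mkset sK.
Qed.

Lemma zagzig_trilinear (K : algType k) (P : quasiHopf K) :
  trilinear_fun (fun a b c =>
    antipode P a * alpha P * b * beta P * antipode P c).
Proof.
by split=> [v w|u]; [|split=> [v|w]] => c x y;
  rewrite ?linearP ?(mulrDr, mulrDl) -?(scalerAl, scalerAr) ?(mulrDr, mulrDl)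
    -?(scalerAl, scalerAr).
Qed.

(* S(u) alpha u = alpha only determines S(u) alpha; as PhiV has its first leg *)
(* in degree 1, S(u) can be moved next to alpha in the zagzig identity.       *)
Lemma antipode_grouplike (I : qhIdeal Q) (u v : quot I) :
  grouplike (quot_quasiHopf I) u -> u * v = 1 -> v * u = 1 ->
  (forall b, @qcomponent _ _ _ _ gr I 1%g b -> u * b = b * u) ->
  antipode (quot_quasiHopf I) u = v.
Proof.
move=> [Du eu] uv vu uc; pose P := quot_quasiHopf I.
have pB := quot_pregrading I faithful_gr.
set B := @qcomponent _ _ _ _ gr I in pB uc.
have vc b : B 1%g b -> v * b = b * v.
  by move=> Bb; rewrite -[b in LHS]mulr1 -uv !mulrA -(mulrA v) -uc // mulrA vu mul1r.
have Sv : antipode P u * alpha P = v * alpha P.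
  rewrite (vc _ (pg_alpha pB)); have := qh_alphaP P u.
  rewrite Du tlift_tens ?eu ?scale1r; last exact: antipode_alpha_bilinear.
  by move=> e; rewrite -[LHS]mulr1 -uv mulrA e.
pose F (a b c : quot I) := antipode P a * alpha P * b * beta P * antipode P c.
have [F1 F2] := zagzig_trilinear P.
have PhiVB : tensor_sub (B 1%g) setT (PhiV P).
  apply: tensor_sub_map (PhiV_mem faithful_gr); first exact: subspace_lspan.
  move=> a t ga _; apply: lspan_mem; exists (qproj I a); first by exists a.
  by exists (tmap (qproj I) (qproj I) t).
have FE t : tensor_sub (B 1%g) setT t ->
    antipode P u * tlift3 F t = v * tlift3 F t.
  apply: (@lspan_sub _ _ _ [set t | antipode P u * tlift3 F t = v * tlift3 F t]).
    have l0 := linear0 (to_linear (tlift3_linear (zagzig_trilinear P))).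
    split=> [|c x y hx hy]; first by rewrite /mkset [tlift3 F 0]l0 !mulr0.
    rewrite /mkset (tlift3_linear (zagzig_trilinear P)) !mulrDr -!scalerAr.
    by congr (_ *: _ + _).
  move=> _ [a Ba [s _ <-]]; rewrite /mkset /tlift3.
  rewrite (tlift_tens (trilinear_tlift (zagzig_trilinear P))).
  have ml w : linear (fun x : quot I => w * x).
    by move=> c x y; rewrite mulrDr -scalerAr.
  rewrite -![_ * tlift _ _]/(to_linear (ml _) _) !linear_tlift /=.
  apply: eq_tlift => b c; rewrite !mulrA; congr (_ * _ * _ * _).
  (* S(u) S(a) = S(a u) = S(u a) = S(a) S(u), after which S(u) alpha = v alpha applies and v moves
     back past S(a), of degree e. *)
  rewrite -!(qh_antipodeM P) -(uc _ Ba) (qh_antipodeM P) -[LHS]mulrA Sv !mulrA.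
  congr (_ * _); apply/esym/vc.
  by rewrite -invg1; apply: (pg_antipode pB).
have := FE _ PhiVB; rewrite /F (qh_zagzig P) !mulr1 //.
Qed.

(** * From an equivariant family to an ideal *)

Section FromFamily.
Variables (N : set G) (normN : normal_subgroup N) (u : G -> K).
Hypothesis eu : equivariant_family gr N u.

Let NM m n : N m -> N n -> N (m * n)%g. Proof. by case: normN => _ + _ _; apply. Qed.
Let NV n : N n -> N n^-1%g. Proof. by case: normN => _ _ + _; apply. Qed.
Let N1 : N 1%g. Proof. by case: normN. Qed.
Let NJ g n : N n -> N (g * n * g^-1)%g. Proof. by case: normN => _ _ _; apply. Qed.

Let uA n (Nn : N n) : A n (u n) := gls_degree eu.1 Nn.
Let uM n m (Nn : N n) (Nm : N m) : u n * u m = u (n * m)%g := gls_mul eu.1 Nn Nm.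

Let u1 : u 1%g = 1.
Proof.
have [v _ [uv _]] := gls_unit eu.1 N1.
transitivity (u 1%g * (u 1%g * v)); first by rewrite uv mulr1.
by rewrite mulrA uM // mulg1.
Qed.

Let uV n : N n -> u n * u n^-1%g = 1.
Proof. by move=> Nn; rewrite uM ?mulgV //; exact: NV. Qed.

Let Vu n : N n -> u n^-1%g * u n = 1.
Proof. by move=> Nn; rewrite uM ?mulVg //; exact: NV. Qed.

(** Expand the conjugate of u_n as the sum of the h_i u_n h_i'. Each h_i' h has degree e and
    commutes with u_n, which leaves h u_n. *)
Lemma family_commute g n h : N n -> A g h -> h * u n = u (g * n * g^-1)%g * h.
Proof.
move=> Nn Ah; rewrite -eu.2 // /gconj; case: xgetP => [s _ [hs s1]|ns]; last first.
  by have [s hs] := pregrading_unit pA g; case: (ns s).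
rewrite mulr_suml -[in LHS](mul1r h) -s1 !mulr_suml.
rewrite big_seq [RHS]big_seq; apply: eq_bigr => p /hs[p1 p2].
rewrite -!mulrA; congr (_ * _); rewrite !mulrA -(gls_comm eu.1 Nn) ?mulrA //.
by rewrite -(mulVg g); apply: (pg_mul pA).
Qed.

Let E : set K := lspan [set (u n - 1) * y | n in N & y in setT].
Let sE : subspace E := subspace_lspan _.

Let E_ind (Z : set K) : subspace Z -> (forall n y, N n -> Z ((u n - 1) * y)) ->
  E `<=` Z.
Proof. by move=> sZ h; apply: lspan_sub => // _ [n Nn [y _ <-]]; apply: h. Qed.

Let Eu n y : N n -> E ((u n - 1) * y).
Proof. by move=> Nn; apply: lspan_mem; exists n => //; exists y. Qed.

Let Er a x : E x -> E (x * a).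
Proof.
apply: (E_ind (Z := [set x | E (x * a)])) => [|n y Nn] /=.
  split=> /= [|c x' y hx hy]; first by rewrite mul0r; exact: lspan0.
  by rewrite mulrDl -scalerAl; apply: sE.2.
by rewrite -mulrA; apply: Eu.
Qed.

(** E is a right ideal by construction. For a of degree g, equivariance turns a (u_n - 1) into (u_m
    - 1) a with m = g n g^-1 in N. *)
Let El a x : E x -> E (a * x).
Proof.
apply: (E_ind (Z := [set x | E (a * x)])) => [|n y Nn] /=.
  split=> /= [|c x' y hx hy]; first by rewrite mulr0; exact: lspan0.
  by rewrite mulrDr -scalerAr; apply: sE.2.
elim/(pregrading_ind pA): a => [|a b ha hb|g a Aa].
- by rewrite mul0r; exact: lspan0.
- by rewrite mulrDl; apply: subspaceD.
rewrite mulrA mulrBr mulr1 (family_commute Nn Aa) -{2}[a]mul1r -mulrBl -mulrA.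
by apply/Eu/NJ.
Qed.

Let Eeps x : E x -> eps (quot_quasiHopf IJ) x = 0.
Proof.
apply: (E_ind (Z := [set x | eps (quot_quasiHopf IJ) x = 0])) => [|n y Nn].
  split=> [|c x' y hx hy]; first by rewrite /mkset linear0.
  transitivity (c * eps (quot_quasiHopf IJ) x' + eps (quot_quasiHopf IJ) y).
    exact: linearP.
  by rewrite (hx : _ = 0) (hy : _ = 0) mulr0 addr0.
have [_ e1] := gls_grouplike eu.1 Nn.
by rewrite /mkset rmorphM rmorphB rmorph1 /= e1 subrr mul0r.
Qed.

Let Eantipode x : E x -> E (antipode (quot_quasiHopf IJ) x).
Proof.
apply: (E_ind (Z := [set x | E (antipode (quot_quasiHopf IJ) x)])) => [|n y Nn].
  split=> [|c x' y hx hy]; first by rewrite /mkset linear0; exact: lspan0.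
  by rewrite /mkset linearP; apply: sE.2.
rewrite /mkset (qh_antipodeM (quot_quasiHopf IJ)); apply: El.
rewrite linearB /= (qh_antipode1 (quot_quasiHopf IJ)).
rewrite (antipode_grouplike (gls_grouplike eu.1 Nn) (uV Nn) (Vu Nn)).
  by rewrite -[_ - 1]mulr1; apply/Eu/NV.
by move=> b; apply: (gls_comm eu.1 Nn).
Qed.

Let EDelta x : E x -> tensor_ideal E (Delta (quot_quasiHopf IJ) x).
Proof.
have sT := subspace_tensor_ideal E.
apply: (E_ind (Z := [set x | tensor_ideal E (Delta (quot_quasiHopf IJ) x)])) => [|n y Nn].
  split=> [|c x' y hx hy]; first by rewrite /mkset linear0; exact: sT.1.
  by rewrite /mkset linearP; apply: sT.2.
have [/= Du _] := gls_grouplike eu.1 Nn.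
rewrite /mkset rmorphM rmorphB rmorph1 /= Du tens1.
elim/tensor_ind: (quot_Delta y) => [|a b ha hb|a b].
- by rewrite mulr0; exact: sT.1.
- by rewrite mulrDr; apply: subspaceD.
(* u ⊗ u - 1 ⊗ 1 = (u - 1) ⊗ u + 1 ⊗ (u - 1), one term for each half of the tensor ideal. *)
rewrite tens_sub mulrDl !tensM.
by apply: subspaceD => //; [apply: tensor_ideall|apply: tensor_idealr]; apply: Eu.
Qed.

Let I := q @^-1` E.

Lemma family_ideal : qh_ideal Q setT I.
Proof.
split=> //.
- split; first by rewrite /I /preimage /mkset linear0; exact: lspan0.
  by move=> a x y Ix Iy; rewrite /I /preimage /mkset linearP; apply: sE.2.
- by move=> a x _ Ix; rewrite /I /preimage /mkset rmorphM; apply: El.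
- by move=> a x _ Ix; rewrite /I /preimage /mkset rmorphM; apply: Er.
- move=> x Ix; apply: tensor_ideal_preim; first exact: lspan0.
  by have := EDelta Ix; rewrite /= quot_DeltaE.
- by move=> x /Eeps; rewrite /= quot_epsE.
- by move=> x /Eantipode; rewrite /= quot_antipodeE.
Qed.

Let untwist g : {linear H -> K} :=
  if pselect (N g) is left _ then to_linear (fun a x y =>
    etrans (congr1 ( *%R (u g^-1%g)) (linearP q a x y))
      (etrans (mulrDr _ _ _) (congr1 (+%R^~ _) (esym (scalerAr _ _ _)))))
  else \0.

Let untwistE g x : N g -> untwist g x = u g^-1%g * q x.
Proof. by rewrite /untwist; case: pselect. Qed.

Let untwist0 g x : ~ N g -> untwist g x = 0.
Proof. by rewrite /untwist; case: pselect. Qed.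

(* graded_map untwist is q in degree 1, and it kills I because it undoes the  *)
(* multiplication by u n.                                                     *)
Lemma graded_untwist_ideal x : I x -> graded_map gr untwist x = 0.
Proof.
have TJ y : induced_ideal J y -> graded_map gr untwist y = 0.
  apply: (@lspan_sub _ _ _ [set y | graded_map gr untwist y = 0]).
    split=> [|c y1 y2 h1 h2]; first by rewrite /mkset linear0.
    transitivity (c *: graded_map gr untwist y1 + graded_map gr untwist y2).
      exact: linearP.
    by rewrite (h1 : _ = 0) (h2 : _ = 0) scaler0 addr0.
  move=> _ [a _ [j Jj <-]] /=.
  elim/(pregrading_ind (faithful_pregrading faithful_gr)): a => [|a b ha hb|g a ga].
  - by rewrite mul0r linear0.
  - by rewrite mulrDl linearD /= ha hb addr0.
  have gaj : gr g (a * j) by rewrite -[g]mulg1; apply: gr_mul => //; exact: qhi_sub hJ _ Jj.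
  rewrite (graded_map_hom _ gaj); have [Ng|nN] := pselect (N g); last exact: untwist0.
  have qj : q j = 0 by apply: (qproj0 (I := IJ)); exact: sub_induced_ideal.
  by rewrite untwistE // rmorphM /= qj !mulr0.
(* Having killed J^G, the map factors through q, so on E any convenient lift may be used. *)
have Tq x1 x2 : q x1 = q x2 -> graded_map gr untwist x1 = graded_map gr untwist x2.
  move=> /qproj_eq /TJ; rewrite linearB /= => /eqP; rewrite subr_eq0 => /eqP //.
suff h : E `<=` [set y | forall x, y = q x -> graded_map gr untwist x = 0].
  by move=> Ix; exact: h Ix x erefl.
move=> {x}; apply: E_ind.
  split=> [x e|c y1 y2 h1 h2 x e].
    by rewrite -(linear0 (graded_map gr untwist)); apply: Tq; rewrite -e linear0.
  rewrite /mkset in h1 h2.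
  have [x1 e1] := qproj_surj y1; have [x2 e2] := qproj_surj y2.
  rewrite (Tq x (c *: x1 + x2)); last by rewrite -e linearP /= e1 e2.
  transitivity (c *: graded_map gr untwist x1 + graded_map gr untwist x2).
    exact: linearP.
  by rewrite h1 // h2 // scaler0 addr0.
move=> n y Nn x e; have [v gv ev] := uA Nn; have [w ew] := qproj_surj y.
rewrite (Tq x (v * w - w)); last first.
  by rewrite -e linearB rmorphM /= ev ew mulrBl mul1r.
move=> {e ew}; elim/(pregrading_ind (faithful_pregrading faithful_gr)): w => [|a b ha hb|g a ga].
- by rewrite mulr0 subrr linear0.
- by rewrite mulrDr opprD addrACA linearD /= ha hb addr0.
rewrite linearB /= (graded_map_hom _ ga) (graded_map_hom _ (gr_mul gv ga)).
(* As n is in N, the degrees n g and g are in N together. In that case (n g)^-1 n = g^-1 makes the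
   two terms cancel; otherwise both are 0. *)
have [Ng|nN] := pselect (N g).
  rewrite !untwistE //; last exact: NM.
  rewrite rmorphM /= mulrA ev uM //; last by apply/NV/NM.
  by rewrite invgM -mulgA mulVg mulg1 subrr.
rewrite !untwist0 ?subrr // => Nng; apply: nN.
by rewrite -[g](mulKg n); apply: NM => //; exact: NV.
Qed.

(** Composed with eps, the untwisting map sums eps(x_h) over h in N, as eps(u_h) = 1. This sum is 0
    on I, while it would be -1 for an x with grading map zeta_g - zeta_e and g outside N.
    Conversely, for g in N, a lift v of u_g in H_g gives v - 1 in I. *)
Lemma family_ideal_subgroup : ideal_subgroup gr I = N.
Proof.
apply/seteqP; split=> g.
  move=> [x Ix ex]; apply: contrapT => nN.
  have g1 : g != 1%g by apply/eqP => e; apply: nN; rewrite e.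
  have := eps_sum (fun h => `[< N h >]) g1 ex.
  have -> : `[< N g >] = false by apply/asboolP.
  have -> : `[< N 1%g >] = true by apply/asboolP.
  have := congr1 (eps (quot_quasiHopf IJ)) (graded_untwist_ideal Ix).
  rewrite linear0 /graded_map linear_sum /= => e.
  rewrite big_mkcond /=.
  suff -> : \sum_(h <- finsupp (decomp gr x))
      (if `[< N h >] then eps Q (decomp gr x h) else 0) = 0.
    by move/eqP; rewrite sub0r eq_sym oppr_eq0 oner_eq0.
  rewrite -[RHS]e; apply: eq_bigr => h _; case: asboolP => Nh; last first.
    by rewrite untwist0 // linear0.
  rewrite untwistE // rmorphM /= quot_epsE.
  by have [_ /= ->] := gls_grouplike eu.1 (NV Nh); rewrite mul1r.
move=> Ng; have [v gv ev] := uA Ng.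
have [_ e1] := gls_grouplike eu.1 Ng.
exists (v - 1).
  by rewrite /I /preimage /mkset linearB rmorph1 /= ev -[_ - 1]mulr1; apply: Eu.
apply/malgP => h; rewrite grading_map_coef mcoeffB !mcoeffU.
have -> : decomp gr (v - 1) h = decomp gr v h - decomp gr 1 h.
  exact: (linearB (to_linear (decomp_linear gr h))).
rewrite (decomp_hom _ gv) (decomp_hom _ (pg_one (faithful_pregrading faithful_gr))).
have ev1 : eps Q v = 1 by rewrite -(quot_epsE IJ) ev.
rewrite linearB /= ![_ == h]eq_sym.
by do 2!case: eqP => _; rewrite ?linear0 ?rmorph1 ?ev1.
Qed.

(** On H_e the untwisting map is q, because u_e = 1; so an element of I in degree e lies in J^G,
    hence in J. *)
Lemma family_ideal_cap : I `&` gr 1%g = J.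
Proof.
apply/seteqP; split=> x.
  move=> [Ix gx]; apply: (induced_ideal_cap faithful_gr hJ) => //.
  have := graded_untwist_ideal Ix; rewrite (graded_map_hom _ gx) untwistE // invg1 u1 mul1r.
  by rewrite -(linear0 q) => /qproj_eq; rewrite subr0.
move=> Jx; split; last exact: qhi_sub hJ _ Jx.
rewrite /I /preimage /mkset (qproj0 (I := IJ)); first exact: lspan0.
exact: sub_induced_ideal.
Qed.

End FromFamily.
End QuotientComponents.

Theorem proposition6p7 (k : fieldType) (G : groupType) (H : algType k)
    (Q : quasiHopf H) (gr : grading G Q) (faithful_gr : faithfully_graded gr)
    (N : set G) (normN : normal_subgroup N)
    (J : set H) (hJ : qh_ideal Q (gr 1%g) J) (invJ : G_invariant gr J) :
  (exists I : set H,
     [/\ qh_ideal Q setT I, ideal_subgroup gr I = N & I `&` gr 1%g = J])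
  <-> admits_equivariant_family N hJ invJ.
Proof.
split=> [[I [hI IN IJ]]|[u eu]].
  exact: (family_of_ideal faithful_gr hJ invJ hI IJ normN IN).
exists (qproj (induced_qhIdeal hJ invJ) @^-1` lspan [set (u n - 1) * y | n in N & y in setT]).
split; [exact: family_ideal|exact: family_ideal_subgroup|exact: family_ideal_cap].
Qed.
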